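(* Let $n\ge 1$ and let $H$ be a finite-dimensional Hopf algebra acting on the $n$th Weyl Poisson algebra $\mathcal W$ (i.e. $\mathcal W$ is an $H$-module Poisson algebra) while preserving its standard filtration. Then the action of $H$ factors through a group algebra.
   Context: $\Bbbk$ is an algebraically closed field of characteristic zero; all algebras are $\Bbbk$-algebras. A Poisson algebra is a commutative algebra $A$ with a bilinear bracket $\{-,-\}$ such that $(A,\{-,-\})$ is a Lie algebra and each $\{a,-\}$ is a derivation of $A$. Sumless Sweedler notation is used: $\Delta(h)=h_1\otimes h_2$ (summation understood). A Poisson algebra $A$ is an $H$-module Poisson algebra if it is a left $H$-module with $h\cdot 1_A=\epsilon(h)1_A$, $h\cdot(ab)=(h_1\cdot a)(h_2\cdot b)$ and $h\cdot\{a,b\}=\{h_1\cdot a,h_2\cdot b\}$ for all $h\in H$, $a,b\in A$. An action of $H$ on $A$ factors through a group algebra if there is a Hopf ideal $I$ of $H$ with $I\cdot A=0$ and $H/I$ isomorphic, as a Hopf algebra, to a group algebra. The $n$th Weyl Poisson algebra is $\mathcal W=\Bbbk[u_1,v_1,\ldots,u_n,v_n]$ with bracket $\{u_i,u_j\}=\{v_i,v_j\}=0$, $\{u_i,v_j\}=\delta_{ij}$. Its standard filtration is given by letting $F_k\mathcal W$ be the span of polynomials of (total) degree at most $k$; the action preserves it if each $F_k\mathcal W$ is an $H$-submodule. *)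

(* Defs.v *)
From HB Require Import structures.
From mathcomp Require Import all_boot all_order all_fingroup all_algebra all_field.
From mathcomp Require Import ring.
From mathcomp Require Import mpoly.

Set Implicit Arguments.
Unset Strict Implicit.
Unset Printing Implicit Defensive.

Import GRing.Theory.
Local Open Scope ring_scope.

(* The tensor product of finite-dimensional spaces, in coordinates with respect
   to [vbasis].  The linear map [tlift b] induced by a bilinear [b] renders
   Sweedler notation: [tlift (fun x y => b x y) (comul h)] is b(h_1, h_2). *)
Definition tens (k : fieldType) (V W : vectType k) : Type :=
  'M[k]_(\dim {:V}, \dim {:W}).

HB.instance Definition _ (k : fieldType) (V W : vectType k) :=
  Vector.copy (tens V W) 'M[k]_(\dim {:V}, \dim {:W}).

Section Tensor.
Variable k : fieldType.

Definition tpure (V W : vectType k) (x : V) (y : W) : tens V W :=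
  \matrix_(i, j) (coord (vbasis {:V}) i x * coord (vbasis {:W}) j y).

Definition tlift (V W : vectType k) (U : lmodType k) (b : V -> W -> U)
    (t : tens V W) : U :=
  \sum_i \sum_j
    (t : 'M_(_, _)) i j *: b (vbasis {:V})`_i (vbasis {:W})`_j.

Definition bilin (V W U : lmodType k) (b : V -> W -> U) : Prop :=
  (forall y, linear (b^~ y)) /\ (forall x, linear (b x)).

End Tensor.
Notation "x \ox y" := (tpure x y) (at level 40, left associativity) : ring_scope.

Section TensorTheory.
Variable k : fieldType.
Implicit Types V W : vectType k.
Implicit Types U : lmodType k.

Lemma bilin_tpure V W : bilin (@tpure k V W).
Proof.
split=> [y|x] a u v; apply/matrixP=> i j; rewrite !mxE linearD linearZ /=.
  by rewrite mulrDl mulrA.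
by rewrite mulrDr mulrCA.
Qed.

Lemma tlift_is_linear V W U (b : V -> W -> U) : linear (tlift b).
Proof.
move=> a u v; rewrite /tlift scaler_sumr -big_split; apply: eq_bigr => i _ /=.
rewrite scaler_sumr -big_split; apply: eq_bigr => j _ /=.
by rewrite !mxE scalerDl scalerA.
Qed.
HB.instance Definition _ V W U (b : V -> W -> U) :=
  GRing.isLinear.Build k (tens V W) U _ (tlift b) (tlift_is_linear b).

Lemma bilin_suml V W U (b : V -> W -> U) (bb : bilin b) I r (P : pred I) F G y :
  b (\sum_(i <- r | P i) F i *: G i) y = \sum_(i <- r | P i) F i *: b (G i) y.
Proof.
have [bl _] := bb; pose L := GRing.isLinear.Build k V U _ (b^~ y) (bl y).
pose f : {linear V -> U} := HB.pack (b^~ y) L.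
by rewrite -[LHS]/(f _) linear_sum; apply: eq_bigr => i _; rewrite linearZ.
Qed.

Lemma bilin_sumr V W U (b : V -> W -> U) (bb : bilin b) I r (P : pred I) F G x :
  b x (\sum_(i <- r | P i) F i *: G i) = \sum_(i <- r | P i) F i *: b x (G i).
Proof.
have [_ br] := bb; pose L := GRing.isLinear.Build k W U _ (b x) (br x).
pose f : {linear W -> U} := HB.pack (b x) L.
by rewrite -[LHS]/(f _) linear_sum; apply: eq_bigr => i _; rewrite linearZ.
Qed.

Lemma tlift_tpure V W U (b : V -> W -> U) x y :
  bilin b -> tlift b (x \ox y) = b x y.
Proof.
move=> bb.
rewrite [in RHS](coord_vbasis (memvf x)) (bilin_suml bb).
apply: eq_bigr => i _; rewrite [in RHS](coord_vbasis (memvf y)) (bilin_sumr bb).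
by rewrite scaler_sumr; apply: eq_bigr => j _; rewrite mxE scalerA.
Qed.

Lemma tens_sum V W (t : tens V W) :
  t = \sum_i \sum_j
    (t : 'M_(_, _)) i j *: ((vbasis {:V})`_i \ox (vbasis {:W})`_j).
Proof.
have fV := basis_free (vbasisP {:V}); have fW := basis_free (vbasisP {:W}).
apply/matrixP=> i j; rewrite summxE (bigD1 i) //= summxE (bigD1 j) //=.
rewrite !mxE !coord_free // !eqxx !mulr1 big1 => [|j' ne]; last first.
  by rewrite !mxE !coord_free // (negbTE ne) !mulr0.
rewrite addr0 big1 ?addr0 // => i' ne; rewrite summxE big1 // => j' _.
by rewrite !mxE !coord_free // (negbTE ne) mul0r mulr0.
Qed.

(* universal property: [tlift b] is the unique linear map with
   [x \ox y |-> b x y] *)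
Lemma tens_ext V W U (f g : tens V W -> U) :
  linear f -> linear g -> (forall x y, f (x \ox y) = g (x \ox y)) -> f =1 g.
Proof.
move=> lf lg e t.
pose f' : {linear tens V W -> U} :=
  HB.pack f (GRing.isLinear.Build k _ U _ f lf).
pose g' : {linear tens V W -> U} :=
  HB.pack g (GRing.isLinear.Build k _ U _ g lg).
rewrite -[f t]/(f' t) -[g t]/(g' t) (tens_sum t) !linear_sum; apply: eq_bigr => i _.
by rewrite !linear_sum; apply: eq_bigr => j _; rewrite !linearZ /= e.
Qed.

Lemma linear_tlift V W U U' (f : U -> U') (b : V -> W -> U) t : linear f ->
  f (tlift b t) = tlift (fun x y => f (b x y)) t.
Proof.
move=> lf; pose f' : {linear U -> U'} :=
  HB.pack f (GRing.isLinear.Build k _ U' _ f lf).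
rewrite -[LHS]/(f' _) linear_sum; apply: eq_bigr => i _.
by rewrite linear_sum; apply: eq_bigr => j _; rewrite linearZ.
Qed.

Lemma eq_tlift V W U (b b' : V -> W -> U) t :
  (forall x y, b x y = b' x y) -> tlift b t = tlift b' t.
Proof.
by move=> e; apply: eq_bigr => i _; apply: eq_bigr => j _; rewrite e.
Qed.

Definition tmap (V W V' W' : vectType k) (f : V -> V') (g : W -> W')
    (t : tens V W) : tens V' W' :=
  tlift (fun x y => f x \ox g y) t.

HB.instance Definition _ V W V' W' f g :=
  GRing.Linear.copy (@tmap V W V' W' f g) (tlift (fun x y => f x \ox g y)).

Lemma tlift_tmap V W V' W' U (b : V' -> W' -> U) (f : V -> V') (g : W -> W') t :
  bilin b -> tlift b (tmap f g t) = tlift (fun x y => b (f x) (g y)) t.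
Proof.
move=> bb; rewrite /tmap linear_tlift; last exact: linearP.
by apply: eq_tlift => x y; rewrite tlift_tpure.
Qed.

Lemma bilin_comp (V W V' W' U : lmodType k) (b : V' -> W' -> U)
  (f : {linear V -> V'}) (g : {linear W -> W'}) :
  bilin b -> bilin (fun x y => b (f x) (g y)).
Proof. by case=> bl br; split=> [y|x] a u v; rewrite linearP (bl, br). Qed.

Lemma bilin_comp_linear (V W U U' : lmodType k) (b : V -> W -> U)
  (f : U -> U') : linear f -> bilin b -> bilin (fun x y => f (b x y)).
Proof. by move=> lf [bl br]; split=> [y|x] a u v; rewrite (bl, br) lf. Qed.

Lemma bilin_mul (A : algType k) : bilin (fun x y : A => x * y).
Proof.
by split=> [y|x] a u v; rewrite (mulrDl, mulrDr) -(scalerAl, scalerAr).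
Qed.

Lemma bilin_scale (V W : lmodType k) (f : {linear V -> k^o}) (g : {linear W -> W}) :
  bilin (fun u v => f u *: g v).
Proof.
split=> [v|u] a u1 v1; rewrite linearP /=.
  by rewrite scalerDl scalerA.
by rewrite scalerDr !scalerA mulrC.
Qed.

Lemma bilin_flip (V W U : lmodType k) (b : V -> W -> U) :
  bilin b -> bilin (fun u v => b v u).
Proof. by case. Qed.

Lemma bilin_tlift (V V1 W1 W : vectType k) (U' : lmodType k)
  (c : V -> V1 -> W1 -> U') (g : {linear W -> tens V1 W1}) :
  (forall y1 y2, linear (fun x => c x y1 y2)) ->
  bilin (fun x y => tlift (c x) (g y)).
Proof.
move=> lc; split=> [y|x] a u v; last by rewrite !linearP.
rewrite /tlift scaler_sumr -big_split; apply: eq_bigr => i _ /=.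
rewrite scaler_sumr -big_split; apply: eq_bigr => j _ /=.
by rewrite lc scalerDr !scalerA mulrC.
Qed.

Definition tensv V W (X : {vspace V}) (Y : {vspace W}) : {vspace tens V W} :=
  <<[seq x \ox y | x <- vbasis X, y <- vbasis Y]>>%VS.

End TensorTheory.

(* The multiplication [comulM] requires of [comul] is that of the tensor
   product algebra, (x \ox y) (x' \ox y') = x x' \ox y y'. *)
HB.mixin Record Falgebra_isHopf (k : fieldType) H of Falgebra k H := {
  comul : {linear H -> tens H H};
  counit : {linear H -> k^o};
  antipode : {linear H -> H};
  comulA : forall h,
    tlift (fun x y => comul x \ox y) (comul h) =
    tlift (fun x y => tlift (fun y1 y2 => (x \ox y1) \ox y2) (comul y))
      (comul h);
  counitl : forall h, tlift (fun x y => counit x *: y) (comul h) = h;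
  counitr : forall h, tlift (fun x y => counit y *: x) (comul h) = h;
  comul1 : comul 1 = 1 \ox 1;
  comulM : forall g h, comul (g * h) =
    tlift (fun x y => tlift (fun x' y' => (x * x') \ox (y * y')) (comul h))
      (comul g);
  counit1 : counit 1 = 1;
  counitM : forall g h, counit (g * h) = counit g * counit h;
  antipodel : forall h,
    tlift (fun x y => antipode x * y) (comul h) = (counit h : k) *: 1;
  antipoder : forall h,
    tlift (fun x y => x * antipode y) (comul h) = (counit h : k) *: 1
}.

#[short(type="fdHopfType")]
HB.structure Definition FdHopf (k : fieldType) :=
  { H of Falgebra k H & Falgebra_isHopf k H }.

Definition hopf_isomorphic (k : fieldType) (H K : fdHopfType k) : Prop :=
  exists f : {lrmorphism H -> K},
    [/\ bijective f,
        forall h, comul (f h) = tmap f f (comul h),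
        forall h, counit (f h) = counit h
      & forall h, antipode (f h) = f (antipode h)].

Record hopfIdeal (k : fieldType) (H : fdHopfType k) := HopfIdeal {
  hopfI_vs :> {vspace H};
  hopfI_mull : forall h x, x \in hopfI_vs -> h * x \in hopfI_vs;
  hopfI_mulr : forall h x, x \in hopfI_vs -> x * h \in hopfI_vs;
  hopfI_comul : forall x, x \in hopfI_vs ->
    comul x \in (tensv hopfI_vs {:H} + tensv {:H} hopfI_vs)%VS;
  hopfI_counit : forall x, x \in hopfI_vs -> counit x = 0;
  hopfI_antipode : forall x, x \in hopfI_vs -> antipode x \in hopfI_vs
}.

(* H/I, realised on a complement of I: [quot_pi] below is linear and onto,
   with kernel I (lemma [quot_pi_eq0]). *)
Definition hopf_quot (k : fieldType) (H : fdHopfType k) (I : hopfIdeal H)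
  : Type := subvs_of (I^C)%VS.

HB.instance Definition _ (k : fieldType) (H : fdHopfType k) (I : hopfIdeal H) :=
  Vector.copy (hopf_quot I) (subvs_of (I^C)%VS).

Section HopfQuotient.
Variables (k : fieldType) (H : fdHopfType k) (I : hopfIdeal H).
Local Notation Q := (hopf_quot I).
Implicit Types g h : H.

Definition quot_repr : Q -> H := vsval.
Definition quot_pi : H -> Q := vsproj (I^C) \o daddv_pi (I^C) I.
HB.instance Definition _ := GRing.Linear.copy quot_repr (vsval : subvs_of _ -> H).
HB.instance Definition _ := GRing.Linear.copy quot_pi
  (vsproj (I^C) \o daddv_pi (I^C) I).

Let capCI : (I^C :&: I = 0)%VS.
Proof. by rewrite capvC capv_compl. Qed.

Lemma quot_reprK : cancel quot_repr quot_pi.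
Proof.
move=> x; rewrite /quot_pi /= daddv_pi_id ?subvsP //; exact: vsvalK.
Qed.

Lemma quot_piK h : h - quot_repr (quot_pi h) \in I.
Proof.
rewrite /quot_pi /quot_repr /= vsprojK ?memv_pi //.
have : h \in (I^C + I)%VS by rewrite addvC addv_complf memvf.
move/(daddv_pi_add capCI) => {1}<-; rewrite addrC addKr; exact: memv_pi.
Qed.

Lemma quot_pi_eq0 h : (quot_pi h == 0) = (h \in I).
Proof.
apply/eqP/idP => [h0|hI].
  by have := quot_piK h; rewrite h0 (linear0 quot_repr) subr0.
have hC : quot_repr (quot_pi h) \in I.
  by rewrite -[quot_repr _](subKr h); apply: memvB => //; apply: quot_piK.
apply: (can_inj quot_reprK); rewrite (linear0 quot_repr); apply/eqP.
by rewrite -memv0 -capCI memv_cap hC andbT subvsP.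
Qed.

Lemma quot_piP g h : g - h \in I -> quot_pi g = quot_pi h.
Proof. by rewrite -quot_pi_eq0 linearB subr_eq0 => /eqP. Qed.

Lemma quot_piE (P : Q -> Prop) : (forall h, P (quot_pi h)) -> forall x, P x.
Proof. by move=> Ph x; rewrite -(quot_reprK x). Qed.

Definition quot_one : Q := quot_pi 1.
Definition quot_mul (x y : Q) : Q := quot_pi (quot_repr x * quot_repr y).

Lemma quot_piM g h : quot_mul (quot_pi g) (quot_pi h) = quot_pi (g * h).
Proof.
apply/esym/quot_piP; set g' := quot_repr _; set h' := quot_repr _.
have -> : g * h - g' * h' = (g - g') * h + g' * (h - h').
  by rewrite mulrBl mulrBr addrA subrK.
by apply: memvD; [apply: hopfI_mulr | apply: hopfI_mull]; apply: quot_piK.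
Qed.

Lemma quot_mulA : associative quot_mul.
Proof.
elim/quot_piE => a; elim/quot_piE => b; elim/quot_piE => c.
by rewrite !quot_piM mulrA.
Qed.
Lemma quot_mul1l : left_id quot_one quot_mul.
Proof. by elim/quot_piE => a; rewrite quot_piM mul1r. Qed.
Lemma quot_mul1r : right_id quot_one quot_mul.
Proof. by elim/quot_piE => a; rewrite quot_piM mulr1. Qed.
Lemma quot_mulDl : left_distributive quot_mul +%R.
Proof.
elim/quot_piE => a; elim/quot_piE => b; elim/quot_piE => c.
by rewrite -linearD !quot_piM mulrDl linearD.
Qed.
Lemma quot_mulDr : right_distributive quot_mul +%R.
Proof.
elim/quot_piE => a; elim/quot_piE => b; elim/quot_piE => c.
by rewrite -linearD !quot_piM mulrDr linearD.
Qed.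
Lemma quot_one_neq0 : quot_one != 0.
Proof.
rewrite quot_pi_eq0; apply/negP => /hopfI_counit/eqP.
by rewrite counit1 oner_eq0.
Qed.

HB.instance Definition _ := GRing.Zmodule_isNzRing.Build Q
  quot_mulA quot_mul1l quot_mul1r quot_mulDl quot_mulDr quot_one_neq0.

Lemma quot_pi_mul g h : quot_pi (g * h) = quot_pi g * quot_pi h.
Proof. by rewrite -quot_piM. Qed.

Lemma quot_scalerAl (a : k) (x y : Q) : a *: (x * y) = (a *: x) * y.
Proof.
elim/quot_piE: x => x; elim/quot_piE: y => y.
by rewrite -quot_pi_mul -!linearZ -quot_pi_mul scalerAl.
Qed.
Lemma quot_scalerAr (a : k) (x y : Q) : a *: (x * y) = x * (a *: y).
Proof.
elim/quot_piE: x => x; elim/quot_piE: y => y.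
by rewrite -quot_pi_mul -!linearZ -quot_pi_mul scalerAr.
Qed.
HB.instance Definition _ := GRing.Lmodule_isLalgebra.Build k Q quot_scalerAl.
HB.instance Definition _ := GRing.Lalgebra_isAlgebra.Build k Q quot_scalerAr.
HB.instance Definition _ := Algebra_isFalgebra.Build k Q.

Definition quot_comul : Q -> tens Q Q :=
  tmap quot_pi quot_pi \o (comul \o quot_repr).
Definition quot_counit : Q -> k^o := counit \o quot_repr.
Definition quot_antipode : Q -> Q := quot_pi \o (antipode \o quot_repr).
HB.instance Definition _ := GRing.Linear.copy quot_comul
  (tmap quot_pi quot_pi \o (comul \o quot_repr)).
HB.instance Definition _ := GRing.Linear.copy quot_counit (counit \o quot_repr).
HB.instance Definition _ := GRing.Linear.copy quot_antipode
  (quot_pi \o (antipode \o quot_repr)).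

Lemma quot_pi_comul h : quot_comul (quot_pi h) = tmap quot_pi quot_pi (comul h).
Proof.
apply/eqP; rewrite eq_sym -subr_eq0 /quot_comul /= -!linearB /=.
have /hopfI_comul := quot_piK h; set t := comul _.
case/memv_addP => t1 t1I [t2 t2I ->]; rewrite linearD /=.
pose F := linfun (tmap quot_pi quot_pi : tens H H -> tens Q Q).
have bq : bilin (fun u v => quot_pi u \ox quot_pi v).
  by apply: bilin_comp; apply: bilin_tpure.
have [bq1 bq2] := bq.
have F1 : (tensv I {:H} <= lker F)%VS.
  apply/span_subvP => _ /allpairsP[[u v] [/= uI _ ->]].
  rewrite memv_ker lfunE /= /tmap tlift_tpure //.
  have /eqP -> : quot_pi u == 0 by rewrite quot_pi_eq0 (vbasis_mem uI).
  by apply/eqP/matrixP=> i j; rewrite !mxE linear0 mul0r.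
have F2 : (tensv {:H} I <= lker F)%VS.
  apply/span_subvP => _ /allpairsP[[u v] [/= _ vI ->]].
  rewrite memv_ker lfunE /= /tmap tlift_tpure //.
  have /eqP -> : quot_pi v == 0 by rewrite quot_pi_eq0 (vbasis_mem vI).
  by apply/eqP/matrixP=> i j; rewrite !mxE linear0 mulr0.
have := subvP F1 _ t1I; have := subvP F2 _ t2I.
by rewrite !memv_ker !lfunE /= => /eqP-> /eqP->; rewrite addr0.
Qed.

Lemma quot_pi_counit h : quot_counit (quot_pi h) = counit h.
Proof.
apply/eqP; rewrite eq_sym -subr_eq0 /quot_counit /= -linearB /=.
by apply/eqP/hopfI_counit/quot_piK.
Qed.

Lemma quot_pi_antipode h : quot_antipode (quot_pi h) = quot_pi (antipode h).
Proof.
apply/eqP; rewrite eq_sym -subr_eq0 /quot_antipode /= -!linearB /=.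
by rewrite quot_pi_eq0; apply/hopfI_antipode/quot_piK.
Qed.

Lemma tlift_quot (U : lmodType k) (b : Q -> Q -> U) h : bilin b ->
  tlift b (quot_comul (quot_pi h)) =
  tlift (fun x y => b (quot_pi x) (quot_pi y)) (comul h).
Proof. by move=> bb; rewrite quot_pi_comul tlift_tmap. Qed.

Lemma quot_comulA (x : Q) :
  tlift (fun x y => quot_comul x \ox y) (quot_comul x) =
  tlift (fun x y => tlift (fun y1 y2 => (x \ox y1) \ox y2) (quot_comul y))
    (quot_comul x).
Proof.
elim/quot_piE: x => h.
have bt V W := @bilin_tpure k V W.
rewrite tlift_quot; last exact: (bilin_comp quot_comul idfun (bt _ _)).
rewrite tlift_quot; last first.
  apply: bilin_tlift => y1 y2 a u v.
  by case: (bt Q Q) => -> _; case: (bt (tens Q Q) Q) => ->.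
pose F : tens (tens H H) H -> tens (tens Q Q) Q :=
  tmap (tmap quot_pi quot_pi) quot_pi.
have lF : linear F by exact: linearP.
have bF : bilin (fun (x : tens H H) (y : H) =>
    tmap quot_pi quot_pi x \ox quot_pi y).
  exact: (bilin_comp (tmap quot_pi quot_pi) quot_pi (bt _ _)).
transitivity (F (tlift (fun x y => comul x \ox y) (comul h))).
  rewrite (linear_tlift _ _ lF); apply: eq_tlift => u v.
  by rewrite /F [tmap (tmap _ _)]/tmap tlift_tpure // quot_pi_comul.
rewrite comulA (linear_tlift _ _ lF); apply: eq_tlift => u v.
rewrite (linear_tlift _ _ lF) tlift_quot; last first.
  by split=> [y'|x'] a u' v'; case: (bt Q Q) => bl br;
     case: (bt (tens Q Q) Q) => bl' br'; rewrite ?br ?bl' ?br'.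
apply: eq_tlift => y1 y2.
rewrite /F [tmap (tmap _ _)]/tmap tlift_tpure // /tmap tlift_tpure //.
exact: (bilin_comp quot_pi quot_pi (bt _ _)).
Qed.

Lemma quot_counitl (x : Q) :
  tlift (fun x y => quot_counit x *: y) (quot_comul x) = x.
Proof.
elim/quot_piE: x => h; rewrite tlift_quot; last exact: (bilin_scale quot_counit idfun).
rewrite -[in RHS](counitl h) linear_tlift; last exact: linearP.
by apply: eq_tlift => u v; rewrite quot_pi_counit linearZ.
Qed.

Lemma quot_counitr (x : Q) :
  tlift (fun x y => quot_counit y *: x) (quot_comul x) = x.
Proof.
elim/quot_piE: x => h; rewrite tlift_quot; last first.
  exact: (bilin_flip (bilin_scale quot_counit idfun)).
rewrite -[in RHS](counitr h) linear_tlift; last exact: linearP.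
by apply: eq_tlift => u v; rewrite quot_pi_counit linearZ.
Qed.

Lemma quot_comul1 : quot_comul 1 = 1 \ox 1.
Proof.
rewrite -[1]/(quot_pi 1) quot_pi_comul comul1 /tmap tlift_tpure //.
exact: (bilin_comp quot_pi quot_pi (@bilin_tpure _ _ _)).
Qed.

Lemma quot_comulM (x y : Q) : quot_comul (x * y) =
  tlift (fun u v => tlift (fun u' v' => (u * u') \ox (v * v')) (quot_comul y))
    (quot_comul x).
Proof.
elim/quot_piE: x => g; elim/quot_piE: y => h.
have [bl br] := @bilin_tpure k Q Q.
have bq : bilin (fun u v => quot_pi u \ox quot_pi v).
  exact: (bilin_comp quot_pi quot_pi (@bilin_tpure _ _ _)).
rewrite tlift_quot; last first.
  split=> [v|u] a u1 v1; rewrite /tlift scaler_sumr -big_split;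
    apply: eq_bigr => i _; rewrite /= scaler_sumr -big_split;
    apply: eq_bigr => j _; rewrite mulrDl -scalerAl (bl, br);
    by rewrite scalerDr !scalerA mulrC.
rewrite -quot_pi_mul quot_pi_comul comulM /tmap linear_tlift; last exact: linearP.
apply: eq_tlift => u v; rewrite linear_tlift; last exact: linearP.
rewrite tlift_quot; last first.
  by split=> [v1|u1] a u2 v2; rewrite mulrDr -scalerAr (bl, br).
by apply: eq_tlift => u' v'; rewrite tlift_tpure // !quot_pi_mul.
Qed.

Lemma quot_counit1 : quot_counit 1 = 1.
Proof. by rewrite -[1]/(quot_pi 1) quot_pi_counit counit1. Qed.

Lemma quot_counitM (x y : Q) : quot_counit (x * y) = quot_counit x * quot_counit y.
Proof.
elim/quot_piE: x => g; elim/quot_piE: y => h.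
by rewrite -quot_pi_mul !quot_pi_counit counitM.
Qed.

Lemma quot_antipodel (x : Q) :
  tlift (fun x y => quot_antipode x * y) (quot_comul x) =
  (quot_counit x : k) *: 1.
Proof.
elim/quot_piE: x => h; rewrite tlift_quot; last first.
  exact: (bilin_comp quot_antipode idfun (@bilin_mul _ _)).
rewrite quot_pi_counit -[1]/(quot_pi 1) -linearZ -antipodel.
rewrite [RHS]linear_tlift; last exact: linearP.
by apply: eq_tlift => u v; rewrite quot_pi_antipode /= quot_pi_mul.
Qed.

Lemma quot_antipoder (x : Q) :
  tlift (fun x y => x * quot_antipode y) (quot_comul x) =
  (quot_counit x : k) *: 1.
Proof.
elim/quot_piE: x => h; rewrite tlift_quot; last first.
  exact: (bilin_comp idfun quot_antipode (@bilin_mul _ _)).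
rewrite quot_pi_counit -[1]/(quot_pi 1) -linearZ -antipoder.
rewrite [RHS]linear_tlift; last exact: linearP.
by apply: eq_tlift => u v; rewrite quot_pi_antipode /= quot_pi_mul.
Qed.

HB.instance Definition _ := Falgebra_isHopf.Build k Q
  quot_comulA quot_counitl quot_counitr quot_comul1 quot_comulM
  quot_counit1 quot_counitM quot_antipodel quot_antipoder.

End HopfQuotient.

(* The group algebra; its product is convolution ([galg_mul_coef]), not the
   pointwise product of {ffun G -> k^o}. *)
Definition galg (k : fieldType) (G : finGroupType) : Type := {ffun G -> k^o}.

HB.instance Definition _ (k : fieldType) (G : finGroupType) :=
  Vector.copy (galg k G) {ffun G -> k^o}.

Section GroupAlgebra.
Variables (k : fieldType) (G : finGroupType).
Local Notation kG := (galg k G).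
Implicit Types a b c : kG.

Definition galg_delta (g : G) : kG := [ffun x => (x == g)%:R].
Local Notation "\e_ g" := (galg_delta g) (at level 8, g at level 2).

Definition galg_coef (g : G) a : k^o := (a : {ffun _ -> _}) g.
Lemma galg_coef_is_linear g : linear (galg_coef g).
Proof. by move=> l a b; rewrite /galg_coef !ffunE. Qed.
HB.instance Definition _ g :=
  GRing.isLinear.Build k kG k^o _ (galg_coef g) (galg_coef_is_linear g).

Lemma galg_coef_delta g h : galg_coef g \e_h = (g == h)%:R.
Proof. by rewrite /galg_coef ffunE. Qed.

Definition galg_ext (U : lmodType k) (f : G -> U) a : U :=
  \sum_g galg_coef g a *: f g.
Lemma galg_ext_is_linear (U : lmodType k) (f : G -> U) : linear (galg_ext f).
Proof.
move=> l a b; rewrite /galg_ext scaler_sumr -big_split; apply: eq_bigr => g _.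
by rewrite linearP scalerDl scalerA.
Qed.
HB.instance Definition _ (U : lmodType k) (f : G -> U) :=
  GRing.isLinear.Build k kG U _ (galg_ext f) (galg_ext_is_linear f).

Lemma galg_ext_delta (U : lmodType k) (f : G -> U) g : galg_ext f \e_g = f g.
Proof.
rewrite /galg_ext (bigD1 g) //= galg_coef_delta eqxx scale1r big1 ?addr0 //.
by move=> h ne; rewrite galg_coef_delta (negbTE ne) scale0r.
Qed.

Lemma galg_sum a : a = \sum_g galg_coef g a *: \e_g.
Proof.
apply/ffunP => x; rewrite sum_ffunE (bigD1 x) //= !ffunE eqxx.
rewrite big1 ?addr0 => [|y ne]; first exact/esym/mulr1.
by rewrite !ffunE eq_sym (negbTE ne); apply: mulr0.
Qed.

Lemma galg_linear_ext (U : lmodType k) (f f' : kG -> U) :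
  linear f -> linear f' -> (forall g, f \e_g = f' \e_g) -> f =1 f'.
Proof.
move=> lf lf' e a.
pose F : {linear kG -> U} := HB.pack f (GRing.isLinear.Build k _ U _ f lf).
pose F' : {linear kG -> U} := HB.pack f' (GRing.isLinear.Build k _ U _ f' lf').
rewrite -[f a]/(F a) -[f' a]/(F' a) (galg_sum a) !linear_sum.
by apply: eq_bigr => g _; rewrite !linearZ /= e.
Qed.

Definition galg_one : kG := \e_1%g.
Definition galg_mul a b : kG :=
  galg_ext (fun g => galg_ext (fun h => \e_(g * h)%g) b) a.

Lemma galg_mul_delta g h : galg_mul \e_g \e_h = \e_(g * h)%g.
Proof. by rewrite /galg_mul !galg_ext_delta. Qed.

Lemma galg_mulPl b : linear (galg_mul^~ b).
Proof. by move=> l a a'; rewrite /galg_mul linearP. Qed.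

Lemma galg_mulPr a : linear (galg_mul a).
Proof.
move=> l b b'; rewrite /galg_mul /galg_ext scaler_sumr -big_split /=.
apply: eq_bigr => g _; rewrite -!/(galg_ext _ _) linearP.
by rewrite scalerDr !scalerA mulrC.
Qed.

Lemma galg_mul_coef a b x :
  galg_coef x (galg_mul a b) = \sum_g galg_coef g a * galg_coef (g^-1 * x)%g b.
Proof.
rewrite /galg_mul {1}/galg_ext linear_sum; apply: eq_bigr => g _.
rewrite linearZ /=; congr (_ * _).
rewrite linear_sum (bigD1 (g^-1 * x)%g) //= linearZ /= galg_coef_delta.
rewrite mulKVg eqxx big1 ?addr0 => [|h ne]; first exact: mulr1.
rewrite linearZ /= galg_coef_delta; case: eqP => [e|_]; last exact: mulr0.
by case/eqP: ne; rewrite e mulKg.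
Qed.

Lemma galg_mulDl : left_distributive galg_mul +%R.
Proof. by move=> a a' b; have := galg_mulPl b 1 a a'; rewrite !scale1r. Qed.
Lemma galg_mulDr : right_distributive galg_mul +%R.
Proof. by move=> a b b'; have := galg_mulPr a 1 b b'; rewrite !scale1r. Qed.
Lemma galg_scalerAl (l : k) a b : l *: galg_mul a b = galg_mul (l *: a) b.
Proof.
have m0 : galg_mul 0 b = 0 by rewrite /galg_mul linear0.
by have := galg_mulPl b l a 0; rewrite /= !addr0 m0 addr0.
Qed.
Lemma galg_scalerAr (l : k) a b : l *: galg_mul a b = galg_mul a (l *: b).
Proof.
have m0 : galg_mul a 0 = 0.
  by rewrite /galg_mul /galg_ext big1 // => g _; rewrite -/(galg_ext _ _) linear0 scaler0.
by have := galg_mulPr a l b 0; rewrite /= !addr0 m0 addr0.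
Qed.

Lemma galg_mulA : associative galg_mul.
Proof.
move=> a b c.
apply: (galg_linear_ext (f := fun a => galg_mul a (galg_mul b c))
  (f' := fun a => galg_mul (galg_mul a b) c)).
- exact: galg_mulPl.
- by move=> l u v; rewrite !galg_mulPl.
move=> g {a}.
apply: (galg_linear_ext (f := fun b => galg_mul \e_g (galg_mul b c))
  (f' := fun b => galg_mul (galg_mul \e_g b) c)).
- by move=> l u v; rewrite galg_mulPl galg_mulPr.
- by move=> l u v; rewrite galg_mulPr galg_mulPl.
move=> h {b}.
apply: (galg_linear_ext (f := fun c => galg_mul \e_g (galg_mul \e_h c))
  (f' := fun c => galg_mul (galg_mul \e_g \e_h) c)).
- by move=> l u v; rewrite !galg_mulPr.
- exact: galg_mulPr.
by move=> x; rewrite !galg_mul_delta mulgA.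
Qed.
Lemma galg_mul1l : left_id galg_one galg_mul.
Proof.
apply: (galg_linear_ext (f := fun c => galg_mul \e_1%g c) (f' := fun c => c)).
- exact: galg_mulPr.
- by [].
by move=> g; rewrite galg_mul_delta mul1g.
Qed.
Lemma galg_mul1r : right_id galg_one galg_mul.
Proof.
apply: (galg_linear_ext (f := fun c => galg_mul c \e_1%g) (f' := fun c => c)).
- exact: galg_mulPl.
- by [].
by move=> g; rewrite galg_mul_delta mulg1.
Qed.
Lemma galg_one_neq0 : galg_one != 0.
Proof.
apply/eqP => /(congr1 (galg_coef 1%g)); rewrite linear0 galg_coef_delta eqxx.
exact/eqP/oner_neq0.
Qed.

HB.instance Definition _ := GRing.Zmodule_isNzRing.Build kG
  galg_mulA galg_mul1l galg_mul1r galg_mulDl galg_mulDr galg_one_neq0.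
HB.instance Definition _ := GRing.Lmodule_isLalgebra.Build k kG galg_scalerAl.
HB.instance Definition _ := GRing.Lalgebra_isAlgebra.Build k kG galg_scalerAr.
HB.instance Definition _ := Algebra_isFalgebra.Build k kG.

Definition galg_comul : kG -> tens kG kG :=
  galg_ext (fun g => \e_g \ox \e_g).
Definition galg_counit : kG -> k^o := galg_ext (fun _ => 1 : k^o).
Definition galg_antipode : kG -> kG := galg_ext (fun g => \e_(g^-1)%g).
HB.instance Definition _ := GRing.Linear.on galg_comul.
HB.instance Definition _ := GRing.Linear.on galg_counit.
HB.instance Definition _ := GRing.Linear.on galg_antipode.

Lemma galg_comul_delta g : galg_comul \e_g = \e_g \ox \e_g.
Proof. exact: galg_ext_delta. Qed.
Lemma galg_counit_delta g : galg_counit \e_g = 1.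
Proof. exact: galg_ext_delta. Qed.
Lemma galg_antipode_delta g : galg_antipode \e_g = \e_(g^-1)%g.
Proof. exact: galg_ext_delta. Qed.
Lemma galg_mulE g h : \e_g * \e_h = \e_(g * h)%g.
Proof. exact: galg_mul_delta. Qed.

Lemma tlift_galg (U : lmodType k) (b : kG -> kG -> U) g :
  bilin b -> tlift b (galg_comul \e_g) = b \e_g \e_g.
Proof. by move=> bb; rewrite galg_comul_delta tlift_tpure. Qed.

Lemma galg_tlift_linear (U : lmodType k) (b : kG -> kG -> U) :
  linear (fun a => tlift b (galg_comul a)).
Proof. by move=> l u v; rewrite !linearP. Qed.

Lemma galg_comulA a :
  tlift (fun x y => galg_comul x \ox y) (galg_comul a) =
  tlift (fun x y => tlift (fun y1 y2 => (x \ox y1) \ox y2) (galg_comul y))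
    (galg_comul a).
Proof.
move: a; apply: galg_linear_ext; try exact: galg_tlift_linear.
have bt V W := @bilin_tpure k V W.
have bb g : bilin (fun y1 y2 : kG => (\e_g \ox y1) \ox y2).
  by split=> [y'|x'] l u v; case: (bt kG kG) => bl br;
     case: (bt (tens kG kG) kG) => bl' br'; rewrite ?br ?bl' ?br'.
move=> g; rewrite tlift_galg; last exact: (bilin_comp galg_comul idfun (bt _ _)).
rewrite tlift_galg ?tlift_galg ?galg_comul_delta //.
apply: bilin_tlift => y1 y2 l u v.
by case: (bt kG kG) => -> _; case: (bt (tens kG kG) kG) => ->.
Qed.

Lemma galg_counitl a : tlift (fun x y => galg_counit x *: y) (galg_comul a) = a.
Proof.
move: a; apply: galg_linear_ext; [exact: galg_tlift_linear | by [] |].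
move=> g; rewrite tlift_galg; last exact: (bilin_scale galg_counit idfun).
by rewrite galg_counit_delta scale1r.
Qed.

Lemma galg_counitr a : tlift (fun x y => galg_counit y *: x) (galg_comul a) = a.
Proof.
move: a; apply: galg_linear_ext; [exact: galg_tlift_linear | by [] |].
move=> g; rewrite tlift_galg; last first.
  exact: (bilin_flip (bilin_scale galg_counit idfun)).
by rewrite galg_counit_delta scale1r.
Qed.

Lemma galg_comul1 : galg_comul 1 = 1 \ox 1.
Proof. exact: galg_comul_delta. Qed.

Lemma galg_comulM a b : galg_comul (a * b) =
  tlift (fun x y => tlift (fun x' y' => (x * x') \ox (y * y')) (galg_comul b))
    (galg_comul a).
Proof.
have [bl br] := @bilin_tpure k kG kG.
have b2 (x y : kG) : bilin (fun x' y' => (x * x') \ox (y * y')).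
  by split=> [v1|u1] l u2 v2; rewrite mulrDr -scalerAr (bl, br).
have b1 (t : tens kG kG) :
    bilin (fun x y => tlift (fun x' y' => (x * x') \ox (y * y')) t).
  split=> [v|u] l u1 v1; rewrite /tlift scaler_sumr -big_split;
    apply: eq_bigr => i _; rewrite /= scaler_sumr -big_split;
    apply: eq_bigr => j _; rewrite mulrDl -scalerAl (bl, br);
    by rewrite scalerDr !scalerA mulrC.
move: a; apply: galg_linear_ext; last 1 first.
- move=> g; rewrite tlift_galg //; move: b; apply: galg_linear_ext.
  + by move=> l u v; rewrite mulrDr -scalerAr linearP.
  + exact: galg_tlift_linear.
  by move=> h; rewrite tlift_galg // !galg_mulE galg_comul_delta.
- by move=> l u v; rewrite mulrDl -scalerAl linearP.
- exact: galg_tlift_linear.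
Qed.

Lemma galg_counit1 : galg_counit 1 = 1.
Proof. exact: galg_counit_delta. Qed.

Lemma galg_counitM a b : galg_counit (a * b) = galg_counit a * galg_counit b.
Proof.
move: a; apply: galg_linear_ext.
- by move=> l u v; rewrite mulrDl -scalerAl linearP.
- by move=> l u v; rewrite linearP mulrDl scalerAl.
move=> g; move: b; apply: galg_linear_ext.
- by move=> l u v; rewrite mulrDr -scalerAr linearP.
- by move=> l u v; rewrite linearP mulrDr scalerAr.
by move=> h; rewrite galg_mulE !galg_counit_delta mul1r.
Qed.

Lemma galg_antipodel a :
  tlift (fun x y => galg_antipode x * y) (galg_comul a) =
  (galg_counit a : k) *: 1.
Proof.
move: a; apply: galg_linear_ext.
- exact: galg_tlift_linear.
- by move=> l u v; rewrite linearP scalerDl scalerA.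
move=> g; rewrite tlift_galg; last first.
  exact: (bilin_comp galg_antipode idfun (@bilin_mul _ _)).
by rewrite galg_antipode_delta galg_mulE mulVg galg_counit_delta scale1r.
Qed.

Lemma galg_antipoder a :
  tlift (fun x y => x * galg_antipode y) (galg_comul a) =
  (galg_counit a : k) *: 1.
Proof.
move: a; apply: galg_linear_ext.
- exact: galg_tlift_linear.
- by move=> l u v; rewrite linearP scalerDl scalerA.
move=> g; rewrite tlift_galg; last first.
  exact: (bilin_comp idfun galg_antipode (@bilin_mul _ _)).
by rewrite galg_antipode_delta galg_mulE mulgV galg_counit_delta scale1r.
Qed.

HB.instance Definition _ := Falgebra_isHopf.Build k kG
  galg_comulA galg_counitl galg_counitr galg_comul1 galg_comulM
  galg_counit1 galg_counitM galg_antipodel galg_antipoder.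

End GroupAlgebra.

Record poissonAlgebra (k : fieldType) (A : comAlgType k) := PoissonAlgebra {
  pbracket :> A -> A -> A;
  pbracket_linearl : forall b, linear (pbracket^~ b);
  pbracket_linearr : forall a, linear (pbracket a);
  pbracket_alt : forall a, pbracket a a = 0;
  pbracket_jacobi : forall a b c,
    pbracket a (pbracket b c) + pbracket b (pbracket c a) +
    pbracket c (pbracket a b) = 0;
  pbracket_leibniz : forall a b c,
    pbracket a (b * c) = pbracket a b * c + b * pbracket a c
}.

Record modulePoissonAlgebra (k : fieldType) (H : fdHopfType k)
    (A : comAlgType k) (P : poissonAlgebra A) (act : H -> A -> A) : Prop := {
  act_linearl : forall a, linear (act^~ a);
  act_linearr : forall h, linear (act h);
  act_one : forall a, act 1 a = a;
  act_mul : forall g h a, act (g * h) a = act g (act h a);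
  act_unit : forall h, act h 1 = (counit h : k) *: 1;
  act_prod : forall h a b,
    act h (a * b) = tlift (fun x y => act x a * act y b) (comul h);
  act_bracket : forall h a b,
    act h (P a b) = tlift (fun x y => P (act x a) (act y b)) (comul h)
}.

(* The group algebra H/I is finite-dimensional, so only finite groups arise. *)
Definition factorsThroughGroupAlgebra (k : fieldType) (H : fdHopfType k)
    (A : lmodType k) (act : H -> A -> A) : Prop :=
  exists I : hopfIdeal H,
    (forall h a, h \in (I : {vspace H}) -> act h a = 0) /\
    exists G : finGroupType, hopf_isomorphic (hopf_quot I) (galg k G).

Section Weyl.
Variables (k : fieldType) (n : nat).
Local Notation W := {mpoly k[n + n]}.
Implicit Types (f g h : W) (i j : 'I_n).

Definition weyl_u i : W := 'X_(lshift n i).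
Definition weyl_v i : W := 'X_(rshift n i).

Let Du i : W -> W := mderiv (lshift n i).
Let Dv i : W -> W := mderiv (rshift n i).

Definition weyl_bracket f g : W :=
  \sum_(i < n) (mderiv (lshift n i) f * mderiv (rshift n i) g
                - mderiv (rshift n i) f * mderiv (lshift n i) g).

Lemma weyl_bracketE f g :
  weyl_bracket f g = \sum_i (Du i f * Dv i g - Dv i f * Du i g).
Proof. by []. Qed.

Lemma weyl_linearl g : linear (weyl_bracket^~ g).
Proof.
move=> l f f'; rewrite /weyl_bracket scaler_sumr -big_split.
apply: eq_bigr => i _; rewrite !linearP /= !mulrDl -!scalerAl scalerBr.
by rewrite opprD addrACA.
Qed.

Lemma weyl_linearr f : linear (weyl_bracket f).
Proof.
move=> l g g'; rewrite /weyl_bracket scaler_sumr -big_split.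
apply: eq_bigr => i _; rewrite !linearP /= !mulrDr -!scalerAr scalerBr.
by rewrite opprD addrACA.
Qed.

Lemma weyl_alt f : weyl_bracket f f = 0.
Proof. by rewrite /weyl_bracket big1 // => i _; rewrite mulrC subrr. Qed.

Lemma weyl_leibniz f g h :
  weyl_bracket f (g * h) = weyl_bracket f g * h + g * weyl_bracket f h.
Proof.
rewrite /weyl_bracket mulr_suml mulr_sumr -big_split.
by apply: eq_bigr => i _; rewrite !mderivM /=; ring.
Qed.

Let T f g h i j : W :=
  Du i f * Dv i (Du j g) * Dv j h - Du i f * Dv i (Dv j g) * Du j h
  - Dv i f * Du i (Du j g) * Dv j h + Dv i f * Du i (Dv j g) * Du j h.

Lemma weyl_bracket2 f g h : weyl_bracket f (weyl_bracket g h) =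
  \sum_i \sum_j T f g h i j - \sum_i \sum_j T f h g i j.
Proof.
rewrite /weyl_bracket -sumrB; apply: eq_bigr => i _.
rewrite !(raddf_sum (mderiv _)) !mulr_sumr -!sumrB; apply: eq_bigr => j _.
by rewrite /= !mderivB !mderivM /T /Du /Dv; ring.
Qed.

Lemma weyl_T_swap f g h :
  \sum_i \sum_j T f g h i j = \sum_i \sum_j T h g f i j.
Proof.
rewrite exchange_big; apply: eq_bigr => i _; apply: eq_bigr => j _.
rewrite /T /Du /Dv ![mderiv (_ n j) (mderiv (_ n i) _)]mderiv_comm.
by ring.
Qed.

Lemma weyl_jacobi f g h :
  weyl_bracket f (weyl_bracket g h) + weyl_bracket g (weyl_bracket h f) +
  weyl_bracket h (weyl_bracket f g) = 0.
Proof.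
rewrite !weyl_bracket2 (weyl_T_swap h g f) (weyl_T_swap f h g).
by rewrite (weyl_T_swap g f h); ring.
Qed.

Definition weyl_poisson : poissonAlgebra W :=
  PoissonAlgebra weyl_linearl weyl_linearr weyl_alt weyl_jacobi weyl_leibniz.

Lemma weyl_bracket_uu i j : weyl_poisson (weyl_u i) (weyl_u j) = 0.
Proof.
rewrite /= /weyl_bracket big1 // => l _; rewrite !mderivX !mnm1E.
by rewrite !eq_lrshift !scale0r mulr0 mul0r subrr.
Qed.

Lemma weyl_bracket_vv i j : weyl_poisson (weyl_v i) (weyl_v j) = 0.
Proof.
rewrite /= /weyl_bracket big1 // => l _; rewrite !mderivX !mnm1E.
by rewrite !eq_rlshift !scale0r mulr0 mul0r subrr.
Qed.

Lemma weyl_bracket_uv i j :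
  weyl_poisson (weyl_u i) (weyl_v j) = (i == j)%:R.
Proof.
have submm (m : 'X_{1..n + n}) : (m - m = 0)%MM by rewrite -{1}[m]add0m addmK.
rewrite /= /weyl_bracket (bigD1 i) //= big1 ?addr0 => [|l ne];
  rewrite !mderivX !mnm1E ?eq_lrshift ?eq_rlshift !eq_lshift !eq_rshift.
  rewrite eqxx !scale0r mul0r subr0 !scale1r submm mpolyX0 mul1r eq_sym.
  by case: eqP => [->|_]; rewrite ?submm ?mpolyX0 ?scale1r ?scale0r.
by rewrite eq_sym (negbTE ne) !scale0r !mul0r subrr.
Qed.

(* [f \in weyl_filtration d] iff f has total degree at most d, since
   [msize f] is 1 + deg f, and 0 for f = 0. *)
Definition weyl_filtration (d : nat) : {pred W} := [pred f | msize f <= d.+1]%N.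

End Weyl.

Definition preservesFiltration (k : fieldType) (n : nat) (H : Type)
    (act : H -> {mpoly k[n + n]} -> {mpoly k[n + n]}) : Prop :=
  forall d h (f : {mpoly k[n + n]}),
    f \in weyl_filtration d -> act h f \in weyl_filtration d.

(* Main.v *)
(* Write h x_i = c_0i(h) + sum_j c_ji(h) x_j, with coefficients in the dual
   algebra H^*.  Expanding h {x_i, a x_l} in two ways and cancelling the invertible
   matrix (c_ji) shows that every c_ji commutes with every matrix coefficient of
   the action; the c_0i commute with each other because x_i x_j = x_j x_i.  Hence
   the subalgebra C of H^* generated by these coefficients is commutative.  It
   contains all matrix coefficients, so its annihilator I acts by zero, and I is a
   Hopf ideal with H/I cocommutative.
   A finite-dimensional cocommutative Hopf algebra Q over an algebraically closed
   field of characteristic zero is a group algebra: the trace form of the regular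
   representation is represented by an integral with counit dim Q <> 0, which makes
   Q^* reduced, so the operators q |-> q_1 a(q_2) are jointly diagonalizable, and
   their eigenvectors are multiples of grouplike elements. *)
From HB Require Import structures.
From mathcomp Require Import all_boot all_order all_fingroup all_algebra all_field.
From mathcomp Require Import mpoly.
Require Import Defs.

Set Implicit Arguments.
Unset Strict Implicit.
Unset Printing Implicit Defensive.

Import GRing.Theory passmx.
Local Open Scope ring_scope.

(** * Convolution algebras *)

Section TensorComplements.
Variable k : fieldType.
Implicit Types V W : vectType k.

Lemma tlift_linear V W (U : lmodType k) (b1 b2 : V -> W -> U) a t :
  tlift (fun x y => a *: b1 x y + b2 x y) t = a *: tlift b1 t + tlift b2 t.
Proof.
rewrite /tlift scaler_sumr -big_split; apply: eq_bigr => i _ /=.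
rewrite scaler_sumr -big_split; apply: eq_bigr => j _ /=.
by rewrite scalerDr !scalerA mulrC.
Qed.

Lemma tlift_add V W (U : lmodType k) (b1 b2 : V -> W -> U) t :
  tlift (fun x y => b1 x y + b2 x y) t = tlift b1 t + tlift b2 t.
Proof.
by rewrite -[tlift b1 t]scale1r -tlift_linear; apply: eq_tlift => x y; rewrite scale1r.
Qed.

Lemma tlift_sub V W (U : lmodType k) (b1 b2 : V -> W -> U) t :
  tlift (fun x y => b1 x y - b2 x y) t = tlift b1 t - tlift b2 t.
Proof.
rewrite -[in RHS]scaleN1r addrC -tlift_linear; apply: eq_tlift => x y.
by rewrite scaleN1r addrC.
Qed.

Lemma tlift_sum V W (U : lmodType k) (I : finType) (P : pred I)
    (b : I -> V -> W -> U) t :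
  tlift (fun x y => \sum_(i | P i) b i x y) t = \sum_(i | P i) tlift (b i) t.
Proof.
rewrite /tlift [RHS]exchange_big; apply: eq_bigr => i _ /=.
by rewrite [RHS]exchange_big; apply: eq_bigr => j _ /=; rewrite scaler_sumr.
Qed.

Lemma tpureZl V W (a : k) (x : V) (y : W) : (a *: x) \ox y = a *: (x \ox y).
Proof. by apply/matrixP=> i j; rewrite !mxE linearZ /= mulrA. Qed.

Lemma tpure_suml V W (I : finType) (F : I -> V) (y : W) :
  (\sum_i F i) \ox y = \sum_i F i \ox y.
Proof.
apply/matrixP=> i j; rewrite !mxE linear_sum mulr_suml summxE.
by apply: eq_bigr => l _; rewrite mxE.
Qed.

Lemma tpureDl V W (x x' : V) (y : W) : (x + x') \ox y = x \ox y + x' \ox y.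
Proof. by apply/matrixP=> i j; rewrite !mxE linearD mulrDl. Qed.

Lemma tpureDr V W (x : V) (y y' : W) : x \ox (y + y') = x \ox y + x \ox y'.
Proof. by apply/matrixP=> i j; rewrite !mxE linearD mulrDr. Qed.

Lemma tlift_entry V W V' W' (b : V -> W -> tens V' W') t i j :
  (tlift b t : 'M_(_, _)) i j = tlift (fun x y => (b x y : 'M_(_, _)) i j : k^o) t.
Proof.
apply: (linear_tlift (f := fun s : tens V' W' => (s : 'M_(_, _)) i j : k^o)).
by move=> l u v; rewrite !mxE.
Qed.

Lemma tlift_exchange V W V' W' (U : lmodType k) (b : V -> W -> V' -> W' -> U) s t :
  tlift (fun x y => tlift (b x y) s) t =
  tlift (fun u v => tlift (fun x y => b x y u v) t) s.
Proof.
transitivity (\sum_i \sum_j \sum_p \sum_q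
  ((t : 'M_(_, _)) i j * (s : 'M_(_, _)) p q) *:
    b (vbasis {:V})`_i (vbasis {:W})`_j (vbasis {:V'})`_p (vbasis {:W'})`_q).
  apply: eq_bigr => i _; apply: eq_bigr => j _; rewrite scaler_sumr.
  apply: eq_bigr => p _; rewrite scaler_sumr; apply: eq_bigr => q _.
  by rewrite scalerA.
under eq_bigr => i _ do rewrite exchange_big.
rewrite exchange_big; apply: eq_bigr => p _ /=.
under eq_bigr => i _ do rewrite exchange_big.
rewrite exchange_big; apply: eq_bigr => q _ /=; rewrite scaler_sumr.
apply: eq_bigr => i _; rewrite scaler_sumr; apply: eq_bigr => j _.
by rewrite scalerA mulrC.
Qed.

(** Trilinearity makes [T] factor through the triple tensor product, where [comulA] applies; T(h_1,
    h_2, h_3) then does not depend on the bracketing. *)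
Lemma tlift_coassoc (H : fdHopfType k) (U : lmodType k) (T : H -> H -> H -> U) h :
    (forall y z, linear (fun x => T x y z)) ->
    (forall x z, linear (fun y => T x y z)) ->
    (forall x y, linear (T x y)) ->
  tlift (fun x z => tlift (fun u v => T u v z) (comul x)) (comul h) =
  tlift (fun x y => tlift (fun u v => T x u v) (comul y)) (comul h).
Proof.
move=> T1 T2 T3.
have b12 z : bilin (fun u v => T u v z) by split=> [y|x]; [exact: T1 | exact: T2].
pose F (t : tens (tens H H) H) : U :=
  tlift (fun (s : tens H H) z => tlift (fun u v => T u v z) s) t.
have bF : bilin (fun (s : tens H H) z => tlift (fun u v => T u v z) s).
  split=> [z|s] a u v; first by rewrite linearP.
  by rewrite -tlift_linear; apply: eq_tlift => x y; rewrite T3.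
have lF : linear F by exact: linearP.
transitivity (F (tlift (fun x y => comul x \ox y) (comul h))).
  by rewrite (linear_tlift _ _ lF); apply: eq_tlift => x z; rewrite /F tlift_tpure.
rewrite comulA (linear_tlift _ _ lF); apply: eq_tlift => x y.
rewrite (linear_tlift _ _ lF); apply: eq_tlift => u v.
by rewrite /F !tlift_tpure.
Qed.

End TensorComplements.

(** * The algebra of linear maps under convolution *)

Section Convolution.
Variables (k : fieldType) (H : fdHopfType k) (A : falgType k).

(* Linear maps under convolution, kept apart from the composition product that
   'Hom carries elsewhere; [conv H k^o] is the dual algebra. *)
Definition conv : Type := 'Hom(H, A).
HB.instance Definition _ := Vector.copy conv 'Hom(H, A).

Definition capp (f : conv) : H -> A := fun_of_lfun f.
HB.instance Definition _ (f : conv) := GRing.Linear.copy (capp f) (fun_of_lfun f).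
Coercion capp : conv >-> Funclass.

Lemma convP (f g : conv) : f =1 g -> f = g.
Proof. by move=> e; apply/lfunP. Qed.

(* Locked so that failing unifications do not unfold convolution products. *)
Definition cmk (f : {linear H -> A}) : conv := locked (linfun f).
Lemma cmkE (f : {linear H -> A}) : cmk f =1 f.
Proof. by move=> h; rewrite /cmk -lock /capp lfunE. Qed.

Lemma convlE a (f g : conv) h : capp (a *: f + g) h = a *: f h + g h.
Proof. by rewrite /capp lfunE /= lfunE. Qed.

Definition conv_mul (f g : conv) : conv :=
  cmk (tlift (fun x y => f x * g y) \o comul).
Definition counit_alg (h : H) : A := (counit h : k)%:A.
Lemma counit_alg_is_linear : linear counit_alg.
Proof. by move=> a u v; rewrite /counit_alg linearP scalerDl scalerA. Qed.
HB.instance Definition _ :=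
  GRing.isLinear.Build k H A _ counit_alg counit_alg_is_linear.
Definition conv_one : conv := cmk counit_alg.

Lemma conv_mulE f g h : conv_mul f g h = tlift (fun x y => f x * g y) (comul h).
Proof. exact: cmkE. Qed.
Lemma conv_oneE h : conv_one h = (counit h : k)%:A.
Proof. exact: cmkE. Qed.

Lemma bilin_conv (f g : conv) : bilin (fun x y => f x * g y).
Proof. exact: (bilin_comp f g (@bilin_mul _ _)). Qed.

Lemma conv_mulA : associative conv_mul.
Proof.
move=> f1 f2 f3; apply: convP => h; rewrite !conv_mulE.
transitivity (tlift (fun x y => tlift (fun u v => f1 x * f2 u * f3 v) (comul y))
  (comul h)).
  apply: eq_tlift => x y; rewrite conv_mulE.
  rewrite (linear_tlift (f := fun z => f1 x * z)); last first.
    by move=> a u v; rewrite mulrDr scalerAr.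
  by apply: eq_tlift => u v; rewrite mulrA.
rewrite -tlift_coassoc.
- apply: eq_tlift => x y; rewrite conv_mulE.
  rewrite (linear_tlift (f := fun z => z * f3 y)); last first.
    by move=> a u v; rewrite mulrDl -scalerAl.
  by [].
- by move=> y z a u v; rewrite linearP !mulrDl -!scalerAl.
- by move=> y z a u v; rewrite linearP mulrDr mulrDl -scalerAr -scalerAl.
by move=> y z a u v; rewrite linearP mulrDr -scalerAr.
Qed.

Lemma conv_mul1l : left_id conv_one conv_mul.
Proof.
move=> f; apply: convP => h; rewrite conv_mulE -[in RHS](counitl h).
rewrite (linear_tlift _ _ (linearP f)).
by apply: eq_tlift => x y; rewrite conv_oneE linearZ /= mulr_algl.
Qed.

Lemma conv_mul1r : right_id conv_one conv_mul.
Proof.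
move=> f; apply: convP => h; rewrite conv_mulE -[in RHS](counitr h).
rewrite (linear_tlift _ _ (linearP f)).
by apply: eq_tlift => x y; rewrite conv_oneE linearZ /= mulr_algr.
Qed.

Lemma conv_mulPl a f1 f2 g :
  conv_mul (a *: f1 + f2) g = a *: conv_mul f1 g + conv_mul f2 g.
Proof.
apply: convP => h; rewrite convlE !conv_mulE -tlift_linear.
by apply: eq_tlift => x y; rewrite convlE mulrDl scalerAl.
Qed.

Lemma conv_mulPr a f1 f2 g :
  conv_mul g (a *: f1 + f2) = a *: conv_mul g f1 + conv_mul g f2.
Proof.
apply: convP => h; rewrite convlE !conv_mulE -tlift_linear.
by apply: eq_tlift => x y; rewrite convlE mulrDr scalerAr.
Qed.

Lemma conv_mulDl : left_distributive conv_mul +%R.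
Proof. by move=> f1 f2 g; rewrite -[f1]scale1r conv_mulPl !scale1r. Qed.
Lemma conv_mulDr : right_distributive conv_mul +%R.
Proof. by move=> g f1 f2; rewrite -[f1]scale1r conv_mulPr !scale1r. Qed.

Lemma conv_one_neq0 : conv_one != 0.
Proof.
apply/eqP => /(congr1 (fun f : conv => f 1)); rewrite conv_oneE counit1.
by rewrite /capp lfunE scale1r => /eqP; rewrite oner_eq0.
Qed.

HB.instance Definition _ := GRing.Zmodule_isNzRing.Build conv
  conv_mulA conv_mul1l conv_mul1r conv_mulDl conv_mulDr conv_one_neq0.

Lemma conv_scalerAl (a : k) (f g : conv) : a *: (f * g) = (a *: f) * g.
Proof.
have m0 : conv_mul 0 g = 0 by exact: mul0r.
by have := conv_mulPl a f 0 g; rewrite m0 !addr0.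
Qed.
Lemma conv_scalerAr (a : k) (f g : conv) : a *: (f * g) = f * (a *: g).
Proof.
have m0 : conv_mul f 0 = 0 by exact: mulr0.
by have := conv_mulPr a g 0 f; rewrite m0 !addr0.
Qed.
HB.instance Definition _ := GRing.Lmodule_isLalgebra.Build k conv conv_scalerAl.
HB.instance Definition _ := GRing.Lalgebra_isAlgebra.Build k conv conv_scalerAr.
HB.instance Definition _ := Algebra_isFalgebra.Build k conv.

Lemma convM (f g : conv) h : capp (f * g) h = tlift (fun x y => f x * g y) (comul h).
Proof. exact: conv_mulE. Qed.
Lemma conv1 h : capp (1 : conv) h = (counit h : k)%:A.
Proof. exact: conv_oneE. Qed.
Lemma convD (f g : conv) h : capp (f + g) h = f h + g h.
Proof. exact: add_lfunE. Qed.
Lemma convZ a (f : conv) h : capp (a *: f) h = a *: f h.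
Proof. exact: scale_lfunE. Qed.
Lemma conv0 h : capp (0 : conv) h = 0.
Proof. exact: zero_lfunE. Qed.
Lemma convB (f g : conv) h : capp (f - g) h = f h - g h.
Proof. by rewrite -scaleN1r convD convZ scaleN1r. Qed.
Lemma conv_sum (I : finType) (F : I -> conv) h : capp (\sum_i F i) h = \sum_i F i h.
Proof. exact: sum_lfunE. Qed.

End Convolution.

(** * Translates of functionals in the dual algebra *)

Section DualTranslations.
Variables (k : fieldType) (H : fdHopfType k).
Local Notation D := (conv H k^o).
Implicit Types (f g : D) (h x : H).

Definition conv_shiftl h f : D := cmk (f \o amull h).
Definition conv_shiftr h f : D := cmk (f \o amulr h).

Lemma conv_shiftlE h f x : conv_shiftl h f x = f (h * x).
Proof. by rewrite cmkE /= lfunE. Qed.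
Lemma conv_shiftrE h f x : conv_shiftr h f x = f (x * h).
Proof. by rewrite cmkE /= lfunE. Qed.

Lemma convM_mul f g x y : capp (f * g) (x * y) =
  tlift (fun u v => tlift (fun u' v' => (f (u * u') * g (v * v') : k^o)) (comul y))
    (comul x).
Proof.
rewrite convM comulM linear_tlift; last exact: linearP.
apply: eq_tlift => u v; rewrite linear_tlift; last exact: linearP.
by apply: eq_tlift => u' v'; rewrite tlift_tpure //; apply: bilin_conv.
Qed.

(** Dual form of [comulM]. It allows stability of a subalgebra under translation to be checked on
    generators. *)
Lemma conv_shiftlM h f g : conv_shiftl h (f * g) =
  tlift (fun x y => conv_shiftl x f * conv_shiftl y g) (comul h).
Proof.
apply: convP => z; rewrite conv_shiftlE convM_mul.
rewrite [RHS](linear_tlift (f := fun w : D => w z)); last first.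
  by move=> l w w'; rewrite convlE.
apply: eq_tlift => x y; rewrite convM.
by apply: eq_tlift => u v; rewrite !conv_shiftlE.
Qed.

Lemma conv_shiftrM h f g : conv_shiftr h (f * g) =
  tlift (fun x y => conv_shiftr x f * conv_shiftr y g) (comul h).
Proof.
apply: convP => z; rewrite conv_shiftrE convM_mul tlift_exchange.
rewrite [RHS](linear_tlift (f := fun w : D => w z)); last first.
  by move=> l w w'; rewrite convlE.
apply: eq_tlift => x y; rewrite convM.
by apply: eq_tlift => u v; rewrite !conv_shiftrE.
Qed.

Lemma conv_shiftlP h r f g :
  conv_shiftl h (r *: f + g) = r *: conv_shiftl h f + conv_shiftl h g.
Proof. by apply: convP => z; rewrite convlE !conv_shiftlE convlE. Qed.
Lemma conv_shiftrP h r f g :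
  conv_shiftr h (r *: f + g) = r *: conv_shiftr h f + conv_shiftr h g.
Proof. by apply: convP => z; rewrite convlE !conv_shiftrE convlE. Qed.

Lemma conv_shiftl1 h : conv_shiftl h 1 = (counit h : k) *: 1.
Proof.
by apply: convP => z; rewrite conv_shiftlE convZ !conv1 counitM [RHS]scalerA.
Qed.
Lemma conv_shiftr1 h : conv_shiftr h 1 = (counit h : k) *: 1.
Proof.
by apply: convP => z; rewrite conv_shiftrE convZ !conv1 counitM [RHS]scalerA mulrC.
Qed.

End DualTranslations.

(** * Cocommutative Hopf algebras in characteristic zero *)

(** Take a rank factorisation M = C R. Cancelling the full-rank outer factors in C R C R = 0 gives R
    C = 0, and tr(C R) = tr(R C). *)
Lemma mxtrace_sq0 (F : fieldType) n (M : 'M[F]_n) : M *m M = 0 -> \tr M = 0.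
Proof.
move=> M2; have [Rfree Cfull] := (row_base_free M, col_base_full M).
move: (col_base M) (row_base M) (mulmx_base M) Rfree Cfull => C R CR Rfree Cfull.
rewrite -CR mxtrace_mulC; suff -> : R *m C = 0 by rewrite mxtrace0.
apply: (row_free_inj Rfree); apply: (row_full_inj Cfull).
by rewrite mul0mx mulmx0 -mulmxA CR mulmxA CR.
Qed.

(** * The regular coaction, its trace form and the integral *)

Section RegularCoaction.
Variables (k : fieldType) (Q : fdHopfType k).
Local Notation D := (conv Q k^o).
Local Notation e := (vbasis {:Q}).
Local Notation d := (\dim {:Q}).
Implicit Types (a b : D) (h x y q : Q).

Definition coordf (i : 'I_d) (q : Q) : k^o := coord e i q.
Lemma coordf_is_linear i : linear (coordf i).
Proof. by move=> l u v; rewrite /coordf linearP. Qed.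
HB.instance Definition _ i :=
  GRing.isLinear.Build k Q k^o _ (coordf i) (coordf_is_linear i).
Definition conv_coord i : D := cmk (coordf i).
Lemma conv_coordE i q : conv_coord i q = coord e i q.
Proof. exact: cmkE. Qed.

Lemma dappP a l x y : (a (l *: x + y) : k) = l * a x + a y.
Proof. exact: (linearP (capp a)). Qed.

Lemma conv_sep x y : (forall a, a x = a y) -> x = y.
Proof.
move=> exy; rewrite (coord_vbasis (memvf x)) (coord_vbasis (memvf y)).
by apply: eq_bigr => i _; have := exy (conv_coord i); rewrite !conv_coordE => ->.
Qed.

Lemma conv_basis a b : (forall i : 'I_d, a e`_i = b e`_i) -> a = b.
Proof.
move=> eab; apply: convP => q; rewrite (coord_vbasis (memvf q)) !linear_sum.
by apply: eq_bigr => i _; rewrite !linearZ /= eab.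
Qed.

(** The hit action of the dual algebra on [Q], transpose to right convolution by [a]: applying b to
    q_1 a(q_2) gives the value of b * a at q. *)
Definition ract a q : Q := tlift (fun x y => (a y : k) *: x) (comul q).
HB.instance Definition _ a :=
  GRing.Linear.copy (ract a) (tlift (fun x y => (a y : k) *: x) \o comul).

Lemma bilin_ract a : bilin (fun x y : Q => (a y : k) *: x).
Proof. exact: (bilin_flip (bilin_scale a idfun)). Qed.

Lemma ractP l a b q : ract (l *: a + b) q = l *: ract a q + ract b q.
Proof.
rewrite /ract -tlift_linear; apply: eq_tlift => x y.
by rewrite convlE scalerDl scalerA.
Qed.

Lemma ract1 q : ract 1 q = q.
Proof.
rewrite -[RHS]counitr; apply: eq_tlift => x y; rewrite conv1.
by congr (_ *: _); apply: mulr1.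
Qed.

(** The counit recovers [a] from [ract a], which makes the representation [rmx] faithful. *)
Lemma counit_ract a q : counit (ract a q) = a q.
Proof.
rewrite linear_tlift; last exact: linearP.
rewrite -[in RHS](counitl q) [RHS]linear_tlift; last exact: linearP.
by apply: eq_tlift => x y; rewrite !linearZ /=; apply: mulrC.
Qed.

Lemma ractM a b q : ract (a * b) q = ract a (ract b q).
Proof.
rewrite {3}/ract [RHS]linear_tlift; last exact: linearP.
transitivity (tlift (fun x z => tlift (fun u v => (b z : k) *: ((a v : k) *: u))
   (comul x)) (comul q)); last first.
  apply: eq_tlift => x z; rewrite linearZ /= /ract.
  by rewrite [in RHS](linear_tlift (f := fun w => (b z : k) *: w)) //; exact: linearP.
rewrite tlift_coassoc; last 1 first.
- by move=> u v l w w'; rewrite dappP scalerDl -scalerA.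
- apply: eq_tlift => x y; rewrite convM.
  rewrite (linear_tlift (f := fun c : k^o => (c : k) *: x)); last first.
    by move=> l u v; rewrite scalerDl scalerA.
  by apply: eq_tlift => u v; rewrite scalerA mulrC.
- by move=> u v l w w'; rewrite !linearP.
by move=> u v l w w'; rewrite dappP scalerDl scalerDr -!scalerA scalerA mulrC -scalerA.
Qed.

Definition lmx h : 'M[k]_d := mxof e e (amull h).
Definition rmx a : 'M[k]_d := mxof e e (linfun (ract a)).

Lemma lmx_is_linear : linear lmx.
Proof. by move=> l x y; rewrite /lmx !linearP. Qed.
HB.instance Definition _ := GRing.isLinear.Build k Q _ _ lmx lmx_is_linear.

(** Matrices act on row vectors, hence the reversed order, here and in [rmxM]. *)
Lemma lmxM x y : lmx (x * y) = lmx y *m lmx x.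
Proof. by rewrite /lmx amullM (mxof_comp _ _ (vbasisP _)). Qed.

Lemma lmx1 : lmx 1 = 1%:M.
Proof. by rewrite /lmx amull1 mxof1 // (basis_free (vbasisP _)). Qed.

Lemma rmxP l a b : rmx (l *: a + b) = l *: rmx a + rmx b.
Proof.
rewrite /rmx -linearP; congr mxof; apply/lfunP => q.
by rewrite lfunE /= add_lfunE scale_lfunE !lfunE /= ractP.
Qed.

Lemma rmxM a b : rmx (a * b) = rmx b *m rmx a.
Proof.
rewrite /rmx -(mxof_comp _ _ (vbasisP _)); congr mxof; apply/lfunP => q.
by rewrite comp_lfunE !lfunE /= ractM.
Qed.

Lemma rmx1 : rmx 1 = 1%:M.
Proof.
rewrite -(@mxof1 _ _ e) ?(basis_free (vbasisP _)) //; congr mxof.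
by apply/lfunP => q; rewrite !lfunE /= ract1.
Qed.

Lemma rmx0 : rmx 0 = 0.
Proof. by have := rmxP (-1) 0 0; rewrite !scaleN1r !addNr. Qed.

Lemma rmx_inj a b : rmx a = rmx b -> a = b.
Proof.
move/(can_inj (mxofK (vbasisP _) (vbasisP _))) => /lfunP eab.
by apply: convP => q; rewrite -!counit_ract; have := eab q; rewrite !lfunE => ->.
Qed.

Lemma mxtrace_mxof (F : 'End(Q)) : \tr (mxof e e F) = \sum_i coord e i (F e`_i).
Proof. by apply: eq_bigr => i _; rewrite !mxE /= vecof_delta. Qed.

(* In a group algebra this is the sum of the group elements. *)
Definition regular_trace : Q :=
  \sum_i tlift (fun x y => coord e i x *: y) (comul e`_i).

(** Pairing [a] with the i-th summand of [regular_trace] gives the i-th diagonal entry of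
    [ract a]. *)
Lemma regular_traceE a : a regular_trace = \tr (rmx a).
Proof.
rewrite mxtrace_mxof linear_sum; apply: eq_bigr => i _.
rewrite lfunE /= /ract -[RHS]/(coordf i _) linear_tlift; last exact: linearP.
rewrite [RHS]linear_tlift; last exact: linearP.
by apply: eq_tlift => x y; rewrite !linearZ /=; apply: mulrC.
Qed.

Lemma ract_mul a y q : ract a (y * q) =
  tlift (fun u v => tlift (fun s t => (a (v * t) : k) *: (u * s)) (comul q))
    (comul y).
Proof.
have bb := bilin_ract a.
rewrite /ract comulM linear_tlift; last exact: linearP.
apply: eq_tlift => u v; rewrite linear_tlift; last exact: linearP.
by apply: eq_tlift => s t; rewrite tlift_tpure.
Qed.

(* q_1 a(h q_2) = S(h_1) (h_2 q)_1 a((h_2 q)_2): up to inner conjugation,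
   translating [a] does not change [ract a]. *)
Lemma ract_shift h a q :
  ract (conv_shiftl h a) q = tlift (fun x y => antipode x * ract a (y * q)) (comul h).
Proof.
pose F v u := tlift (fun s t => (a (v * t) : k) *: (u * s)) (comul q).
have FE u v : F v u = u * F v 1.
  rewrite /F (linear_tlift (f := fun z => u * z)); last first.
    by move=> l z z'; rewrite mulrDr scalerAr.
  by apply: eq_tlift => s t; rewrite mul1r scalerAr.
have Fl u : linear (F^~ u).
  move=> l v v'; rewrite /F -tlift_linear; apply: eq_tlift => s t.
  by rewrite mulrDl -scalerAl dappP scalerDl -scalerA.
transitivity (tlift (fun x y => tlift (fun u v => antipode x * F v u) (comul y))
  (comul h)); last first.
  apply: eq_tlift => x y; rewrite ract_mul.
  by rewrite [RHS](linear_tlift (f := fun z => antipode x * z)) // => l z z';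
    rewrite mulrDr scalerAr.
(* Here [F v u] is u q_1 a(v q_2), so u pulls out on the left; after regrouping, S(h_1) h_2
   collapses to the counit and [F h 1] remains. *)
rewrite -(tlift_coassoc (T := fun x u v => antipode x * F v u)); last 1 first.
- by move=> x u l v v'; rewrite Fl mulrDr scalerAr.
- transitivity (F h 1).
    by apply: eq_tlift => s t; rewrite conv_shiftlE mul1r.
  rewrite -[in LHS](counitl h) (linear_tlift _ _ (Fl 1)).
  apply: eq_tlift => x v; transitivity (((counit x : k) *: 1 : Q) * F v 1).
    rewrite mulr_algl; have := Fl 1 (counit x) v 0; rewrite addr0 => ->.
    by have := Fl 1 (-1) 0 0; rewrite !scaleN1r !addNr => ->; rewrite addr0.
  rewrite -antipodel (linear_tlift (f := fun z => z * F v 1)); last first.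
    by move=> l z z'; rewrite mulrDl -scalerAl.
  by apply: eq_tlift => x' u; rewrite [in RHS]FE mulrA.
- by move=> u v l x x'; rewrite linearP mulrDl -scalerAl.
by move=> x v l u u'; rewrite (FE (_ + _)) (FE u v) (FE u' v) mulrDl -scalerAl
  mulrDr -scalerAr.
Qed.

Hypothesis comulC : forall q, tlift (fun x y => y \ox x) (comul q) = comul q.

Lemma tlift_comulC (U : lmodType k) (b : Q -> Q -> U) h : bilin b ->
  tlift b (comul h) = tlift (fun x y => b y x) (comul h).
Proof.
move=> bb; rewrite -[in LHS]comulC linear_tlift; last exact: linearP.
by apply: eq_tlift => x y; rewrite tlift_tpure.
Qed.

Lemma convC a b : a * b = b * a.
Proof.
apply: convP => h; rewrite !convM tlift_comulC; last exact: bilin_conv.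
by apply: eq_tlift => x y; apply: mulrC.
Qed.

(** By [ract_shift] the operator is a sum of products of left multiplication by S(h_1), [ract a] and
    left multiplication by h_2. Cyclicity of the trace joins the outer factors into h_2 S(h_1), and
    cocommutativity turns this into h_1 S(h_2), the counit. *)
Lemma mxtrace_shift h a : \tr (rmx (conv_shiftl h a)) = (counit h : k) * \tr (rmx a).
Proof.
have trP : linear (fun M : 'M[k]_d => (\tr M : k^o)) by move=> l M N; rewrite linearP.
pose B x y := lmx y *m rmx a *m lmx (antipode x).
have -> : rmx (conv_shiftl h a) = tlift B (comul h).
  rewrite /B /rmx /lmx.
  under eq_tlift => x y do rewrite -!(mxof_comp _ _ (vbasisP _)).
  rewrite -(linear_tlift (f := mxof e e)); last exact: linearP.
  congr mxof; apply/lfunP => q; rewrite lfunE /= ract_shift.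
  rewrite (linear_tlift (f := fun F : 'End(Q) => F q)); last first.
    by move=> l F G; rewrite add_lfunE scale_lfunE.
  by apply: eq_tlift => x y; rewrite !comp_lfunE !lfunE.
transitivity (\tr (rmx a *m lmx ((counit h : k) *: 1))); last first.
  by rewrite linearZ /= lmx1 -scalemxAr mulmx1 mxtraceZ.
rewrite -antipoder (linear_tlift (f := lmx)); last exact: linearP.
rewrite (linear_tlift (f := fun M : 'M_d => rmx a *m M)); last exact: linearP.
have trE (B' : Q -> Q -> 'M[k]_d) t :
  (\tr (tlift B' t) : k^o) = tlift (fun x y => (\tr (B' x y) : k^o)) t.
  exact: (@linear_tlift k Q Q 'M[k]_d k^o (fun M => \tr M) B' t trP).
rewrite -[LHS]/(\tr _ : k^o) -[RHS]/(\tr _ : k^o) !trE tlift_comulC; last first.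
  split=> [y|x] l u v; rewrite /B.
    by rewrite (linearP antipode) (linearP lmx) mulmxDr -scalemxAr mxtraceD mxtraceZ.
  by rewrite (linearP lmx) !mulmxDl -!scalemxAl mxtraceD mxtraceZ.
apply: (@eq_tlift k Q Q k^o) => x y.
by rewrite /B lmxM -mulmxA mxtrace_mulC mulmxA.
Qed.

Lemma regular_trace_integral h : h * regular_trace = (counit h : k) *: regular_trace.
Proof.
apply: conv_sep => a.
by rewrite -conv_shiftlE linearZ /= !regular_traceE mxtrace_shift.
Qed.

Hypothesis pchar0 : [pchar k] =i pred0.

(** The counit is the unit of the dual algebra, so its value here is the trace of the identity, dim
    Q; characteristic zero keeps it nonzero. *)
Lemma counit_regular_trace_neq0 : counit regular_trace != 0.
Proof.
have -> : counit regular_trace = (1 : D) regular_trace.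
  by rewrite conv1; apply/esym/mulr1.
rewrite regular_traceE rmx1 mxtrace1.
move/pcharf0P: pchar0 => ->; rewrite dimv_eq0; apply/negP => /eqP Q0.
by have := memvf (1 : Q); rewrite Q0 memv0 oner_eq0.
Qed.

(* If b^2 = 0 then b is in the radical of the trace form, i.e. L_1 b(L_2) = 0 for
   the integral L; then b(x) counit(L) = b(x S(L_1) L_2) vanishes for all x. *)
Lemma conv_reduced b : b * b = 0 -> b = 0.
Proof.
have := regular_traceE; have := regular_trace_integral.
have := counit_regular_trace_neq0; move: regular_trace => L eL0 Lint LE b2.
(* Pairing with [a] gives the trace of [rmx (a * b)], and a * b squares to zero by commutativity. *)
have bL : ract b L = 0.
  apply: conv_sep => a; rewrite linear0 -counit_ract -ractM counit_ract.
  rewrite LE mxtrace_sq0 // -rmxM.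
  by rewrite mulrA -(mulrA a) (convC b) -!mulrA b2 !mulr0 rmx0.
(* By [ract_shift] and h_2 L = counit(h_2) L, every translate of [b] kills [L] as well. *)
have shL h : ract (conv_shiftl h b) L = 0.
  rewrite ract_shift -[RHS](mulr0 (antipode h)) -[in RHS]bL.
  rewrite -[in RHS](counitr h) [RHS](linear_tlift (f := fun z => antipode z * ract b L)).
    by apply: eq_tlift => x y; rewrite Lint !linearZ /= -scalerAl -scalerAr.
  by move=> l x y; rewrite linearP mulrDl -scalerAl.
(* The e_i-coefficient of L_1 b(h L_2) vanishes for each i separately, so h may depend on i; it is
   taken below to be x S(e_i). *)
have cL i h : \sum_j (comul L : 'M_(_, _)) i j * b (h * e`_j) = 0.
  transitivity (coord e i (ract (conv_shiftl h b) L)); last by rewrite shL linear0.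
  rewrite /ract /tlift linear_sum [RHS](bigD1 i) //= [X in _ + X]big1 ?addr0.
    rewrite linear_sum; apply: eq_bigr => j _; rewrite !linearZ /= conv_shiftlE.
    by rewrite coord_free ?(basis_free (vbasisP _)) // eqxx mulr1.
  move=> i' ne; rewrite linear_sum big1 // => j _; rewrite !linearZ /=.
  by rewrite coord_free ?(basis_free (vbasisP _)) // (negbTE ne) !mulr0.
apply: convP => x; rewrite conv0; apply/eqP.
have : (counit L : k) * b x = 0.
  transitivity (b (x * ((counit L : k) *: 1))).
    by rewrite -scalerAr mulr1 linearZ.
  rewrite -antipodel (linear_tlift (f := fun z => x * z)); last first.
    by move=> l y z; rewrite mulrDr -scalerAr.
  rewrite linear_tlift; last exact: linearP.
  by rewrite /tlift big1 // => i _; rewrite -[RHS](cL i (x * antipode e`_i));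
    apply: eq_bigr => j _; rewrite mulrA.
by move/eqP; rewrite mulf_eq0 (negbTE eL0).
Qed.

End RegularCoaction.

(** Let q be the product of the X - x over the distinct roots x of the minimal polynomial of [A]. A
    power of q is divisible by that polynomial, so q(A) is nilpotent, hence zero since [S] is
    reduced: the minimal polynomial has simple roots. *)
Lemma reduced_diagonalizable (k : closedFieldType) n (S : 'M[k]_n -> Prop) :
    S 1%:M -> (forall l A B, S A -> S B -> S (l *: A + B)) ->
    (forall A B, S A -> S B -> S (A *m B)) ->
    (forall A, S A -> A *m A = 0 -> A = 0) ->
  forall A, S A -> diagonalizable A.
Proof.
case: n S => [|n] S S1 SD SM S0 A SA; first by rewrite [A]thinmx0; exact: diagonalizable0.
have hS p : S (horner_mx A p).
  elim/poly_ind: p => [|p c IH]; rewrite ?rmorph0 ?rmorphD ?rmorphM /=.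
    by have := SD (-1) _ _ S1 S1; rewrite scaleN1r addNr.
  rewrite horner_mx_X horner_mx_C addrC -scalemx1.
  by apply: SD => //; apply: SM.
(* From B^m = 0 follows B^(2^m) = 0, and [S0] then halves the exponent m times. *)
have nil m B : S B -> B ^+ m = 0 -> B = 0.
  move=> SB Bm; have {Bm} : B ^+ (2 ^ m) = 0.
    by rewrite -(subnK (ltnW (ltn_expl m (ltnSn 1)))) exprD Bm mulr0.
  elim: m => [//|m IH]; rewrite expnSr exprM expr2 => B2; apply/IH/S0 => //.
  elim: (2 ^ m)%N => [|j SBj]; first by rewrite expr0.
  by rewrite exprS; apply: SM.
have [r pA] := closed_field_poly_normal (mxminpoly A).
move: pA; rewrite (monicP (mxminpoly_monic A)) scale1r => pA.
apply/diagonalizableP; exists (undup r); first exact: undup_uniq.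
set q := \prod_(x <- _) _; apply: mxminpoly_min.
apply: (nil (size r)) => //; rewrite -rmorphXn; apply/mxminpoly_minP; rewrite pA.
have dv s : {subset s <= undup r} -> \prod_(x <- s) ('X - x%:P) %| q ^+ size s.
  elim: s => [|x s IH] sr; first by rewrite big_nil dvd1p.
  rewrite big_cons exprS dvdp_mul // ?IH //; last first.
    by move=> y ys; rewrite sr // inE ys orbT.
  by rewrite dvdp_XsubCl root_prod_XsubC sr // mem_head.
by apply: dv => x; rewrite mem_undup.
Qed.

Record grouplikeBasis (k : fieldType) (Q : fdHopfType k) := GrouplikeBasis {
  gb :> (\dim {:Q}).-tuple Q;
  gb_basis : basis_of {:Q} gb;
  gb_comul : forall x, x \in gb -> comul x = x \ox x;
  gb_counit : forall x, x \in gb -> counit x = 1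
}.

Section GrouplikeEigenvectors.
Variables (k : fieldType) (Q : fdHopfType k).
Local Notation e := (vbasis {:Q}).

(** Expanding the second leg in the basis, the coefficient of e_i is the hit action of the i-th
    coordinate functional; joint eigenvectors thus have a pure tensor as comultiplication. *)
Lemma comul_ract (q : Q) : comul q = \sum_i ract (conv_coord i) q \ox e`_i.
Proof.
rewrite [LHS]tens_sum exchange_big; apply: eq_bigr => j _ /=.
rewrite /ract /tlift tpure_suml; apply: eq_bigr => i _.
rewrite [X in _ = X \ox _](bigD1 j) //= big1 ?addr0 => [|j' ne].
  by rewrite conv_coordE coord_free ?(basis_free (vbasisP _)) // eqxx scale1r tpureZl.
rewrite conv_coordE coord_free ?(basis_free (vbasisP _)) // (negbTE ne).
by rewrite scale0r scaler0.
Qed.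

(* A joint eigenvector q of the operators [ract a] satisfies Delta q = q (x) g. *)
Lemma grouplike_of_tpure (q g : Q) : q != 0 -> comul q = q \ox g ->
  exists2 c : k, c != 0 & [/\ g = c *: q, comul g = g \ox g & counit g = 1].
Proof.
(* The left counit axiom reads counit(q) g = q, so the scalar c is the inverse of counit(q). *)
move=> q0 qg; have := counitl q; rewrite qg tlift_tpure; last first.
  exact: (bilin_scale counit idfun).
move=> qE; have c0 : (counit q : k) != 0.
  by apply: contra_neq q0 => c0; rewrite -qE c0 scale0r.
have gE : g = (counit q : k)^-1 *: q by rewrite -[X in _ = _ *: X]qE scalerA mulVf // scale1r.
exists (counit q : k)^-1; first by rewrite invr_eq0.
split=> //.
  by rewrite [in LHS]gE linearZ /= qg -tpureZl -gE.
have := counitr q; rewrite qg tlift_tpure; last first.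
  exact: (bilin_flip (bilin_scale (@counit k Q) idfun)).
move/eqP; rewrite -subr_eq0 -[X in _ - X]scale1r -scalerBl scaler_eq0 (negbTE q0) orbF.
by rewrite subr_eq0 => /eqP.
Qed.
End GrouplikeEigenvectors.

Lemma cocommutative_grouplikeBasis (k : closedFieldType) (Q : fdHopfType k) :
    [pchar k] =i pred0 ->
    (forall q : Q, tlift (fun x y => y \ox x) (comul q) = comul q) ->
  inhabited (grouplikeBasis Q).
Proof.
move=> pchar0 comulC; set e := vbasis {:Q}.
pose As := [seq rmx (@conv_coord k Q i) | i <- enum 'I_(\dim {:Q})].
(* [S] is the image of the dual algebra, which [conv_reduced] shows to be free of nonzero
   square-zero elements. *)
pose S M := exists a : conv Q k^o, M = rmx a.
have Sdiag M : S M -> diagonalizable M.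
  apply: reduced_diagonalizable => [|l _ _ [a ->] [b ->]|_ _ [a ->] [b ->]|_ [a ->]].
  - by exists 1; rewrite rmx1.
  - by exists (l *: a + b); rewrite rmxP.
  - by exists (b * a); rewrite rmxM.
  by rewrite -rmxM -rmx0 => /rmx_inj /(conv_reduced comulC pchar0) ->.
have AsP M : M \in As -> S M by case/mapP => i _ ->; exists (conv_coord i).
have [P Pu /allP/= PAs] : codiagonalizable As.
  apply/codiagonalizableP; split=> [M N /AsP[a ->] /AsP[b ->]|M /AsP/Sdiag //].
  by rewrite /comm_mx -!rmxM (convC comulC).
have /fin_all_exists[D PD] i : exists D, P *m rmx (@conv_coord k Q i) = diag_mx D *m P.
  have /PAs/diagonalizable_forPex[D /(simmxP Pu) PD] : rmx (conv_coord i) \in As.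
    by apply: map_f; rewrite mem_enum.
  by exists D.
(* The rows of [P] are joint eigenvectors; [g i] packs the eigenvalues belonging to row i into the
   second leg of the comultiplication of [q i]. *)
pose q i := vecof e (row i P); pose g i : Q := \sum_j D j 0 i *: e`_j.
have qg i : comul (q i) = q i \ox g i.
  rewrite comul_ract /g (bilin_sumr (bilin_tpure Q Q)); apply: eq_bigr => j _.
  have -> : ract (conv_coord j) (q i) = D j 0 i *: q i.
    rewrite -[LHS](lfunE (ract (conv_coord j))) /q (hom_vecof _ (vbasisP _)) -/(rmx _).
    by rewrite -row_mul PD row_mul row_diag_mx -scalemxAl -rowE linearZ.
  exact: tpureZl.
have q0 i : q i != 0.
  rewrite vecof_eq0 ?vbasisP // rowE -(mul0mx _ P).
  rewrite (inj_eq (row_free_inj _)) ?row_free_unit //.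
  by apply/eqP => /matrixP/(_ 0 i)/eqP; rewrite !mxE !eqxx oner_eq0.
have /fin_all_exists2[c c0 gP] i := grouplike_of_tpure (q0 i) (qg i).
exists; exists [tuple g i | i < \dim {:Q}] => [|_ /mapP[i _ ->]|_ /mapP[i _ ->]];
  [|by have [] := gP i|by have [] := gP i].
rewrite basisEdim size_tuple leqnn andbT; apply/subvP => x _.
rewrite -[x](rVofK (vbasisP _)) -[rVof _ _](mulmxKV Pu) mulmx_sum_row linear_sum.
apply: memv_suml => i _; rewrite linearZ /= -/(q i).
have -> : q i = (c i)^-1 *: g i by have [-> _ _] := gP i; rewrite scalerA mulVf // scale1r.
by do 2 apply: memvZ; apply/memv_span/map_f; rewrite mem_enum.
Qed.

(** * The group of grouplikes and its group algebra *)

Section GrouplikeGroup.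
Variables (k : fieldType) (Q : fdHopfType k) (B : grouplikeBasis Q).
Implicit Types x y : Q.

Lemma gb_ext (U : lmodType k) (f f' : Q -> U) : linear f -> linear f' ->
  {in (gb B), f =1 f'} -> f =1 f'.
Proof.
move=> lf lf' ff' q.
pose F : {linear Q -> U} := HB.pack f (GRing.isLinear.Build k Q U _ f lf).
pose F' : {linear Q -> U} := HB.pack f' (GRing.isLinear.Build k Q U _ f' lf').
rewrite -[f q]/(F q) -[f' q]/(F' q) (coord_basis (gb_basis B) (memvf q)) !linear_sum.
apply: eq_bigr => i _; rewrite !linearZ /=; congr (_ *: _).
by apply: ff'; rewrite mem_nth // size_tuple.
Qed.

(** Applying the i-th coordinate functional to the second leg of the comultiplication of x in two
    ways gives x_i x = x_i b_i. Some x_i is nonzero because counit(x) = 1, so x = b_i. Hence the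
    basis holds all grouplikes and is closed under products. *)
Lemma grouplike_gb x : comul x = x \ox x -> counit x = 1 -> x \in gb B.
Proof.
move=> dx ex; have fB := basis_free (gb_basis B).
pose f i : {linear Q -> k^o} := HB.pack (fun q => coord B i q : k^o)
  (GRing.isLinear.Build k Q k^o _ (fun q => coord B i q : k^o) (linearP (coord B i))).
have key i : coord B i x *: x = coord B i x *: B`_i.
  transitivity (ract (cmk (f i)) x).
    rewrite /ract dx tlift_tpure; last exact: bilin_ract.
    by rewrite cmkE.
  rewrite [in LHS](coord_basis (gb_basis B) (memvf x)) linear_sum (bigD1 i) //=.
  rewrite big1 ?addr0 => [|j ne]; rewrite linearZ /= /ract
    (@gb_comul _ _ B) ?mem_nth ?size_tuple //;
    rewrite tlift_tpure ?cmkE /= ?coord_free //; try exact: bilin_ract.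
    by rewrite eqxx scale1r.
  by rewrite (negbTE ne) scale0r scaler0.
have [i xi|x0] := pickP (fun i => coord B i x != 0).
  have -> : x = B`_i by apply: (scalerI xi); apply: key.
  by rewrite mem_nth // size_tuple.
have x00 : x = 0.
  rewrite (coord_basis (gb_basis B) (memvf x)) big1 // => i _.
  by have /negbFE/eqP -> := x0 i; rewrite scale0r.
by move/eqP: ex; rewrite x00 linear0 eq_sym oner_eq0.
Qed.

Lemma gb_mul x y : x \in gb B -> y \in gb B -> x * y \in gb B.
Proof.
move=> xB yB; apply: grouplike_gb; last by rewrite counitM !(@gb_counit _ _ B) // mulr1.
have [bl br] := @bilin_tpure k Q Q.
rewrite comulM !(@gb_comul _ _ B) //.
transitivity (tlift (fun u v => (u * y) \ox (v * y)) (x \ox x)).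
  apply: eq_tlift => u v; rewrite tlift_tpure //.
  by split=> [w|w] l w1 w2; rewrite mulrDr -scalerAr (bl, br).
rewrite tlift_tpure //.
by split=> [w|w] l w1 w2; rewrite mulrDl -scalerAl (bl, br).
Qed.

Lemma gb_one : 1 \in gb B.
Proof. by apply: grouplike_gb; rewrite ?comul1 ?counit1. Qed.

Definition grouplikes : Type := seq_sub (gb B).
HB.instance Definition _ := Finite.copy grouplikes (seq_sub (gb B)).
HB.instance Definition _ := SubType.copy grouplikes (seq_sub (gb B)).

Definition gl_one : grouplikes := SeqSub gb_one.
Definition gl_mul (g h : grouplikes) : grouplikes := SeqSub (gb_mul (valP g) (valP h)).

Lemma gb_antipodel x : x \in gb B -> antipode x * x = 1.
Proof.
move=> xB; have := antipodel x; rewrite (@gb_comul _ _ B) // (@gb_counit _ _ B) // scale1r.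
by rewrite tlift_tpure //; exact: (bilin_comp antipode idfun (@bilin_mul _ _)).
Qed.

Lemma gb_antipoder x : x \in gb B -> x * antipode x = 1.
Proof.
move=> xB; have := antipoder x; rewrite (@gb_comul _ _ B) // (@gb_counit _ _ B) // scale1r.
by rewrite tlift_tpure //; exact: (bilin_comp idfun antipode (@bilin_mul _ _)).
Qed.

(* Left multiplication by a grouplike is injective on a finite set, hence onto. *)
Lemma gb_antipode x : x \in gb B -> antipode x \in gb B.
Proof.
move=> xB; pose g : grouplikes := SeqSub xB.
have gI : injective (gl_mul g).
  move=> y z /(congr1 val) /= /(congr1 ( *%R (antipode x))).
  by rewrite !mulrA gb_antipodel // !mul1r => /val_inj.
have [h gh] : exists h, gl_mul g h = gl_one.
  by exists (invF gI gl_one); rewrite f_invF.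
move/(congr1 val): gh => /= /(congr1 ( *%R (antipode x))).
by rewrite mulrA gb_antipodel // mul1r mulr1 => <-; apply: valP.
Qed.

Definition gl_inv (g : grouplikes) : grouplikes := SeqSub (gb_antipode (valP g)).

Lemma gl_mulA : associative gl_mul.
Proof. by move=> g h l; apply: val_inj; rewrite /= mulrA. Qed.
Lemma gl_mul1g : left_id gl_one gl_mul.
Proof. by move=> g; apply: val_inj; rewrite /= mul1r. Qed.
Lemma gl_mulg1 : right_id gl_one gl_mul.
Proof. by move=> g; apply: val_inj; rewrite /= mulr1. Qed.
Lemma gl_mulVg : left_inverse gl_one gl_inv gl_mul.
Proof. by move=> g; apply/val_inj/(gb_antipodel (valP g)). Qed.
Lemma gl_mulgV : right_inverse gl_one gl_inv gl_mul.
Proof. by move=> g; apply/val_inj/(gb_antipoder (valP g)). Qed.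
HB.instance Definition _ :=
  isGroup.Build grouplikes gl_mulA gl_mul1g gl_mulg1 gl_mulVg gl_mulgV.

Local Notation kG := (galg k grouplikes).

Definition gl_tnth i : grouplikes := SeqSub (mem_tnth i B).
Definition to_galg (x : Q) : kG := \sum_i coord B i x *: galg_delta k (gl_tnth i).
Lemma to_galg_is_linear : linear to_galg.
Proof.
move=> l x y; rewrite /to_galg scaler_sumr -big_split; apply: eq_bigr => i _.
by rewrite linearP scalerDl scalerA.
Qed.
HB.instance Definition _ := GRing.isLinear.Build k Q kG _ to_galg to_galg_is_linear.

Lemma to_galg_gb (g : grouplikes) : to_galg (val g) = galg_delta k g.
Proof.
have [i gi] : exists i, g = gl_tnth i.
  by case/tnthP: (valP g) => i gi; exists i; apply: val_inj.
rewrite gi /to_galg /= (tnth_nth 0) (bigD1 i) //=.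
rewrite coord_free ?(basis_free (gb_basis B)) // eqxx scale1r big1 ?addr0 //.
move=> j ne; rewrite coord_free ?(basis_free (gb_basis B)) //.
by rewrite eq_sym (negbTE ne) scale0r.
Qed.

Lemma to_galg_in x (xB : x \in gb B) : to_galg x = galg_delta k (SeqSub xB : grouplikes).
Proof. by rewrite -to_galg_gb. Qed.

Lemma to_galg_monoid : monoid_morphism to_galg.
Proof.
split; first by rewrite (to_galg_in gb_one).
move=> x y; move: x; apply: gb_ext => [l u v|l u v|x xB].
- by rewrite mulrDl -scalerAl linearP.
- by rewrite linearP mulrDl -scalerAl.
move: y; apply: gb_ext => [l u v|l u v|y yB].
- by rewrite mulrDr -scalerAr linearP.
- by rewrite linearP mulrDr -scalerAr.
by rewrite (to_galg_in (gb_mul xB yB)) (to_galg_in xB) (to_galg_in yB) galg_mulE.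
Qed.
HB.instance Definition _ := GRing.isMonoidMorphism.Build Q kG to_galg to_galg_monoid.

Lemma to_galg_bij : bijective to_galg.
Proof.
exists (galg_ext (fun g : grouplikes => val g)).
  apply: gb_ext => [l u v|//|x xB]; first by rewrite !linearP.
  by rewrite (to_galg_in xB) galg_ext_delta.
apply: galg_linear_ext => [l u v|//|g]; first by rewrite !linearP.
by rewrite galg_ext_delta to_galg_gb.
Qed.

Lemma grouplikeBasis_galg : hopf_isomorphic Q kG.
Proof.
exists to_galg; split; first exact: to_galg_bij.
- apply: gb_ext => [l u v|l u v|x xB]; try by rewrite !linearP.
  rewrite [X in comul X](to_galg_in xB) [LHS]galg_comul_delta.
  rewrite (@gb_comul _ _ B) // /tmap tlift_tpure.
    by rewrite /= (to_galg_in xB).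
  exact: (bilin_comp to_galg to_galg (@bilin_tpure _ _ _)).
- apply: gb_ext => [l u v|l u v|x xB]; try by rewrite !linearP.
  by rewrite [X in counit X](to_galg_in xB) [LHS]galg_counit_delta (@gb_counit _ _ B).
apply: gb_ext => [l u v|l u v|x xB]; try by rewrite !linearP.
rewrite [X in antipode X](to_galg_in xB) [LHS]galg_antipode_delta /=.
by rewrite (to_galg_in (gb_antipode xB)).
Qed.

End GrouplikeGroup.

Theorem cocommutative_group_algebra (k : closedFieldType) (Q : fdHopfType k) :
    [pchar k] =i pred0 ->
    (forall q : Q, tlift (fun x y => y \ox x) (comul q) = comul q) ->
  exists G : finGroupType, hopf_isomorphic Q (galg k G).
Proof.
move=> pchar0 /(cocommutative_grouplikeBasis pchar0)[B].
by exists (grouplikes B); apply: grouplikeBasis_galg.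
Qed.

(** * Hopf ideals as annihilators *)

(** [agenv U] is a sum of powers of [U], and each power is spanned by products with one generator
    peeled off on the left. *)
Lemma agenv_ind (k : fieldType) (A : falgType k) (U : {vspace A}) (P : A -> Prop) :
    P 1 -> (forall l x y, P x -> P y -> P (l *: x + y)) ->
    (forall u x, u \in U -> P x -> P (u * x)) ->
  forall x, x \in agenv U -> P x.
Proof.
move=> P1 PD PM.
have P0 : P 0 by have := PD (-1) 1 1 P1 P1; rewrite scaleN1r addNr.
have Pspan s : (forall x, x \in s -> P x) -> forall x, x \in <<s>>%VS -> P x.
  elim: s => [|y s IH] Ps x; first by rewrite span_nil memv0 => /eqP->.
  rewrite span_cons => /memv_addP[_ /vlineP[l ->] [z zs ->]].
  apply: PD; first exact/Ps/mem_head.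
  by apply: IH => // w ws; apply: Ps; rewrite inE ws orbT.
have PX i : forall x, x \in (U ^+ i)%VS -> P x.
  elim: i => [|i IH] x.
    by rewrite expv0 => /vlineP[l ->]; rewrite -[_ *: _]addr0; apply: PD.
  rewrite expvSl [@prodv _ _]unlock; apply: Pspan => _ /allpairsP[[u v] [/= uU vU ->]].
  by apply: PM; [apply: vbasis_mem | apply/IH/vbasis_mem].
move=> x /memv_sumP[f fU ->]; apply: big_ind => // [y z Py Pz|i _].
  by rewrite -[y]scale1r; apply: PD.
by apply: (PX i); apply: fU.
Qed.

Section AgenvInverse.
Variables (k : fieldType) (A : falgType k).

(** Multiplication by x is injective on the finite-dimensional [agenv <[x]>], hence onto; a preimage
    of 1 must be y. *)
Lemma agenv_inv (x y : A) : x * y = 1 -> y * x = 1 -> y \in agenv <[x]>.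
Proof.
move=> xy yx; set E := agenv _.
have xE : x \in E by apply: (subvP (sub_agenv _)); apply: memv_line.
have /eqP lx : (amull x @: E == E)%VS.
  rewrite eqEdim; apply/andP; split.
    apply/subvP => _ /memv_imgP[z zE ->]; rewrite lfunE /=.
    by rewrite -[E]agenvM memv_mul.
  rewrite limg_dim_eq //; apply/eqP; rewrite -subv0; apply/subvP => z.
  rewrite memv_cap memv_ker lfunE /= => /andP[_ /eqP xz].
  by rewrite memv0 -[z]mul1r -yx -mulrA xz mulr0.
have : 1 \in (amull x @: E)%VS by rewrite lx memvE sub1_agenv.
case/memv_imgP => z zE; rewrite lfunE /= => /(congr1 ( *%R y)).
by rewrite mulrA yx mul1r mulr1 => ->.
Qed.

End AgenvInverse.

Section TensorSubspaces.
Variable k : fieldType.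
Implicit Types V W : vectType k.

Lemma tlift_tensv V W (U : vectType k) (b : V -> W -> U)
    (X : {vspace V}) (Y : {vspace W}) (Z : {vspace U}) t :
    bilin b -> (forall x y, x \in X -> y \in Y -> b x y \in Z) ->
  t \in tensv X Y -> tlift b t \in Z.
Proof.
move=> bb bZ tXY; pose F := linfun (tlift b : tens V W -> U).
have : (tensv X Y <= F @^-1: Z)%VS.
  apply/span_subvP => _ /allpairsP[[u v] [/= uX vY ->]].
  by rewrite -memv_preim lfunE /= tlift_tpure // bZ ?vbasis_mem.
by move/subvP/(_ _ tXY); rewrite -memv_preim lfunE.
Qed.

Lemma tpure_tensv V W (X : {vspace V}) (Y : {vspace W}) x y :
  x \in X -> y \in Y -> x \ox y \in tensv X Y.
Proof.
move=> xX yY; rewrite (coord_vbasis xX) (bilin_suml (bilin_tpure _ _)).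
apply: memv_suml => i _; apply: memvZ.
rewrite (coord_vbasis yY) (bilin_sumr (bilin_tpure _ _)).
apply: memv_suml => j _; apply: memvZ; apply/memv_span/allpairsP.
by exists ((vbasis X)`_i, (vbasis Y)`_j); split; rewrite ?mem_nth ?size_tuple.
Qed.

Lemma tlift_memv V W (U : vectType k) (b : V -> W -> U) (Z : {vspace U}) t :
  (forall x y, b x y \in Z) -> tlift b t \in Z.
Proof. by move=> bZ; do 2 (apply: memv_suml => ? _); apply: memvZ. Qed.

End TensorSubspaces.

(** * Bi-ideals, and annihilators of subalgebras of the dual *)

Section Biideals.
Variables (k : fieldType) (H : fdHopfType k).

(* The antipode is the convolution inverse of the identity, hence a convolution
   polynomial in it because [conv H H] is finite-dimensional. *)
Lemma biideal_antipode (I : {vspace H}) :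
    (forall h x, x \in I -> h * x \in I) -> (forall h x, x \in I -> x * h \in I) ->
    (forall x, x \in I -> comul x \in (tensv I {:H} + tensv {:H} I)%VS) ->
    (forall x, x \in I -> counit x = 0) ->
  forall x, x \in I -> antipode x \in I.
Proof.
move=> Il Ir Id Ie; pose i : conv H H := cmk idfun; pose s : conv H H := cmk antipode.
have is1 : i * s = 1.
  apply: convP => h; rewrite convM conv1 -antipoder.
  by apply: eq_tlift => x y; rewrite !cmkE.
have si1 : s * i = 1.
  apply: convP => h; rewrite convM conv1 -antipodel.
  by apply: eq_tlift => x y; rewrite !cmkE.
suff Pall (f : conv H H) : f \in agenv <[i]> -> forall x, x \in I -> capp f x \in I.
  by move=> x xI; rewrite -[antipode x]cmkE; apply: Pall => //; apply: agenv_inv.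
move: f; apply: agenv_ind => [x xI|l f g If Ig x xI|_ f /vlineP[l ->] If x xI].
- by rewrite conv1 Ie // scale0r mem0v.
- by rewrite convlE memvD ?memvZ ?If ?Ig.
rewrite -scalerAl convZ memvZ // convM.
have /memv_addP[t1 t1I [t2 t2I ->]] := Id x xI.
rewrite linearD memvD //; [move: t1I | move: t2I]; apply: tlift_tensv;
  try exact: bilin_conv.
  by move=> y z yI _; rewrite cmkE Ir.
by move=> y z _ zI; rewrite cmkE Il // If.
Qed.

Local Notation D := (conv H k^o).
Implicit Types (f g : D) (C : {vspace D}) (h : H).

Definition annih C : {vspace H} :=
  (\bigcap_(i < \dim C) lker ((vbasis C)`_i : 'Hom(H, k^o)))%VS.

Lemma annihP C h : reflect (forall f, f \in C -> f h = 0) (h \in annih C).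
Proof.
rewrite /annih memvE; apply: (iffP subv_bigcapP) => [hC f fC|hC i _].
  rewrite (coord_vbasis fC) conv_sum big1 // => i _; rewrite convZ.
  have := hC i isT; rewrite -memvE memv_ker => /eqP hi.
  by rewrite [X in _ *: X]hi scaler0.
by rewrite -memvE memv_ker; apply/eqP/hC; rewrite vbasis_mem // mem_nth ?size_tuple.
Qed.

(** Double annihilator in finite dimension: the columns of the cokernel of the matrix of [C] are
    vectors in [annih C], so [f] kills them and lies in the row space. *)
Lemma annih_annih C f : (forall h, h \in annih C -> f h = 0) -> f \in C.
Proof.
move=> fC; pose e := vbasis {:H}.
pose M : 'M[k]_(\dim C, \dim {:H}) := \matrix_(i, j) capp (vbasis C)`_i e`_j.
pose v : 'rV[k]_(\dim {:H}) := \row_j f e`_j.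
have vecE (g : D) (u : 'cV[k]_(\dim {:H})) :
    g (\sum_(j < \dim {:H}) u j 0 *: e`_j) =
    \sum_(j < \dim {:H}) (g e`_j : k) * u j 0.
  by rewrite linear_sum; apply: eq_bigr => j _; rewrite linearZ; apply: mulrC.
have /submxP[w vE] : (v <= M)%MS.
  rewrite submxE; apply/eqP/rowP => l; rewrite !mxE.
  pose h := \sum_(j < \dim {:H}) col l (cokermx M) j 0 *: e`_j.
  have hC : h \in annih C.
    apply/annihP => g gC; rewrite (coord_vbasis gC) conv_sum big1 // => i _.
    rewrite convZ vecE; have := mulmx_coker M => /matrixP/(_ i l).
    rewrite !mxE => Mi; rewrite [X in _ *: X](_ : _ = 0) ?scaler0 // -[RHS]Mi.
    by apply: eq_bigr => j _; rewrite !mxE.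
  by rewrite -[RHS](fC h hC) vecE; apply: eq_bigr => j _; rewrite !mxE.
have -> : f = \sum_(i < \dim C) w 0 i *: (vbasis C)`_i.
  apply: conv_basis => j; rewrite conv_sum.
  move/rowP/(_ j): vE; rewrite !mxE => ->; apply: eq_bigr => i _.
  by rewrite convZ !mxE.
by apply: memv_suml => i _; apply/memvZ/vbasis_mem; rewrite mem_nth ?size_tuple.
Qed.

(** Let p project onto the annihilator and r = 1 - p. Functionals composed with r lie in [C] by
    [annih_annih], so their products kill x, i.e. r (x) r kills the comultiplication of x. What
    remains of the identity is p (x) 1 + r (x) p. *)
Lemma annih_comul C x : (forall f g, f \in C -> g \in C -> f * g \in C) ->
  x \in annih C -> comul x \in (tensv (annih C) {:H} + tensv {:H} (annih C))%VS.
Proof.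
move=> CM xC; set I := annih C; set t := comul x.
pose p := projv I; pose r : 'End(H) := (\1 - p)%VF.
have pI h : p h \in I by apply: memv_proj.
have rI h : h \in I -> r h = 0.
  by move=> hI; rewrite /r lfunE /= lfunE /= opp_lfunE projv_id // subrr.
have rC (f : D) : (cmk (f \o r) : D) \in C.
  by apply: annih_annih => h hI; rewrite cmkE /= rI // linear0.
have rr : tlift (fun x y => r x \ox r y) t = 0.
  apply/matrixP => i j; rewrite [RHS]mxE tlift_entry.
  have /annihP/(_ _ (CM _ _ (rC (conv_coord i)) (rC (conv_coord j)))) := xC.
  rewrite convM -/t => <-; apply: (@eq_tlift k H H k^o) => y z; rewrite mxE !cmkE /=.
  by rewrite !conv_coordE.
have pr h : h = p h + r h by rewrite /r lfunE /= lfunE /= opp_lfunE addrC subrK.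
have -> : t = tlift (fun x y => p x \ox y) t + tlift (fun x y => r x \ox p y) t.
  rewrite -[RHS]addr0 -rr -!tlift_add [LHS]tens_sum; apply: eq_tlift => y z.
  by rewrite -addrA -tpureDr -pr -tpureDl -pr.
by apply: memv_add; apply: tlift_memv => u v; apply: tpure_tensv; rewrite ?memvf.
Qed.

(** Dually, the unit gives the counit condition, products the coideal condition and translations the
    two-sided ideal; the antipode follows by [biideal_antipode]. *)
Lemma annih_hopfIdeal C :
    1 \in C -> (forall f g, f \in C -> g \in C -> f * g \in C) ->
    (forall f h, f \in C -> conv_shiftl h f \in C) ->
    (forall f h, f \in C -> conv_shiftr h f \in C) ->
  exists I : hopfIdeal H, (I : {vspace H}) = annih C.
Proof.
move=> C1 CM Cl Cr.
have Il h x : x \in annih C -> h * x \in annih C.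
  by move=> /annihP xC; apply/annihP => f /(Cl _ h)/xC; rewrite conv_shiftlE.
have Ir h x : x \in annih C -> x * h \in annih C.
  by move=> /annihP xC; apply/annihP => f /(Cr _ h)/xC; rewrite conv_shiftrE.
have Id x : x \in annih C -> _ := annih_comul CM.
have Ie x : x \in annih C -> counit x = 0.
  by move=> /annihP/(_ _ C1); rewrite conv1 => <-; apply/esym/mulr1.
by exists (HopfIdeal Il Ir Id Ie (biideal_antipode Il Ir Id Ie)).
Qed.

(** Functionals on the quotient pull back into [C]; the coordinates of the comultiplication and of
    its flip are values of a_i * a_j and a_j * a_i. *)
Lemma hopf_quot_comulC C (I : hopfIdeal H) : (I : {vspace H}) = annih C ->
    (forall f g, f \in C -> g \in C -> f * g = g * f) ->
  forall q : hopf_quot I, tlift (fun x y => y \ox x) (comul q) = comul q.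
Proof.
move=> IC CC; elim/quot_piE => h; have bt := @bilin_tpure k (hopf_quot I) (hopf_quot I).
have piC i : (cmk (conv_coord i \o quot_pi I) : D) \in C.
  apply: annih_annih => x; rewrite -IC -quot_pi_eq0 cmkE /= => /eqP ->.
  exact: linear0.
rewrite [comul _]quot_pi_comul tlift_tmap; last exact: bilin_flip.
apply/matrixP => i j; rewrite /tmap !tlift_entry.
pose a l : D := cmk (conv_coord l \o quot_pi I).
have aE l x : a l x = coord (vbasis {:hopf_quot I}) l (quot_pi I x).
  by rewrite cmkE /= conv_coordE.
transitivity (capp (a j * a i) h).
  rewrite convM; apply: (@eq_tlift k H H k^o) => x y.
  by rewrite mxE !aE; apply: mulrC.
rewrite CC ?convM; [|exact: piC|exact: piC].
by apply: (@eq_tlift k H H k^o) => x y; rewrite mxE !aE.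
Qed.

End Biideals.

(** * Filtered actions on the Weyl Poisson algebra *)

Section AffinePolynomials.
Variables (k : fieldType) (n : nat).
Local Notation W := {mpoly k[n + n]}.
Implicit Types (f g : W) (i j : 'I_(n + n)).

Lemma msize2_coef0 f m : (msize f <= 2)%N -> (1 < mdeg m)%N -> f@_m = 0.
Proof. by move=> f2 m2; apply/memN_msupp_eq0/msize_mdeg_ge/(leq_trans f2). Qed.

Lemma msize2_expand f : (msize f <= 2)%N ->
  f = f@_0 *: 1 + \sum_j f@_U_(j) *: 'X_j.
Proof.
move=> f2; apply/mpolyP => m; rewrite mcoeffD mcoeffZ mcoeff1 linear_sum /=.
case: (ltnP 1 (mdeg m)) => m1.
  rewrite msize2_coef0 // -mdeg_eq0 big1 => [|j _].
    by rewrite addr0 gtn_eqF ?mulr0 // ltnW.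
  rewrite mcoeffZ mcoeffX; case: eqP => [mE|_]; last by rewrite mulr0.
  by move: m1; rewrite -mE mdeg1.
case: (posnP (mdeg m)) => [/eqP|m0].
  rewrite mdeg_eq0 => /eqP ->; rewrite eqxx mulr1 big1 ?addr0 // => j _.
  by rewrite mcoeffZ mcoeffX mnm1_eq0 mulr0.
have /mdeg1P[i /eqP ->] : mdeg m == 1%N by rewrite eqn_leq m1.
rewrite mnm1_eq0 mulr0 add0r (bigD1 i) //= mcoeffZ mcoeffXU eqxx mulr1.
by rewrite big1 ?addr0 // => j ji; rewrite mcoeffZ mcoeffXU (negbTE ji) mulr0.
Qed.

Lemma msize2_deriv f i : (msize f <= 2)%N -> mderiv i f = f@_U_(i) *: 1.
Proof.
move=> f2; apply/mpolyP => m; rewrite mcoeff_deriv mcoeffZ mcoeff1.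
case: eqP => [->|/eqP m0]; first by rewrite add0m mnm0E mulr1.
rewrite msize2_coef0 ?mul0rn ?mulr0 // mdegD mdeg1 addn1 ltnS.
by rewrite lt0n mdeg_eq0.
Qed.

(** Affine polynomials have constant derivatives, so their bracket is a scalar: the symplectic form
    of the linear parts. *)
Lemma weyl_bracket_affine f g : (msize f <= 2)%N -> (msize g <= 2)%N ->
  weyl_poisson k n f g = (\sum_s (f@_U_(lshift n s) * g@_U_(rshift n s)
                         - f@_U_(rshift n s) * g@_U_(lshift n s))) *: 1.
Proof.
move=> f2 g2; rewrite /= /weyl_bracket scaler_suml; apply: eq_bigr => s _.
have algM (p q : k) : (p *: 1 : W) * (q *: 1) = (p * q) *: 1.
  by rewrite mulr_algl scalerA.
by rewrite !msize2_deriv // !algM scalerBl.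
Qed.

End AffinePolynomials.

Section TripleConvolution.
Variables (k : fieldType) (H : fdHopfType k).
Local Notation D := (conv H k^o).

Lemma conv3 (f g l : D) h : capp (f * (g * l)) h =
  tlift (fun x y => tlift (fun u v => (f x * g u * l v : k^o)) (comul y)) (comul h).
Proof.
rewrite convM; apply: eq_tlift => x y; rewrite convM.
rewrite (linear_tlift (f := fun z : k^o => f x * z)); last first.
  by move=> a u v; rewrite mulrDr scalerAr.
by apply: eq_tlift => u v; apply: mulrA.
Qed.

(** The shape of both sides of [coef_bracket]. *)
Lemma conv3_sum (I : finType) (f g l f' g' l' : I -> D) h :
  capp (\sum_s (f s * (g s * l s) - f' s * (g' s * l' s))) h =
  tlift (fun x y => tlift (fun u v => (\sum_s
    (f s x * g s u * l s v - f' s x * g' s u * l' s v) : k^o)) (comul y)) (comul h).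
Proof.
rewrite conv_sum; under [RHS]eq_tlift => x y do rewrite tlift_sum.
rewrite tlift_sum; apply: eq_bigr => s _; rewrite convB !conv3 -tlift_sub.
by apply: eq_tlift => x y; rewrite tlift_sub.
Qed.

End TripleConvolution.

(** * Cancelling an invertible matrix over a noncommutative ring *)

Section SymplecticCancellation.
Variable R : pzRingType.

Lemma commutator_mulB (a x y u v : R) :
  (x * a - a * x) * u - (y * a - a * y) * v =
  x * (a * u) - y * (a * v) - (a * (x * u) - a * (y * v)).
Proof. by rewrite !mulrBl !mulrA !opprB addrACA [RHS]addrACA [- _ - _]addrC. Qed.

(** Multiplying the relation by [d] on the right and summing over l replaces [c] by the identity;
    taking r in the half opposite to j isolates [B j] up to sign. *)
Lemma symplectic_cancel n (B : 'I_(n + n) -> R) (c d : 'I_(n + n) -> 'I_(n + n) -> R) :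
    (forall p r, \sum_l c p l * d l r = (p == r)%:R) ->
    (forall l, \sum_s (B (lshift n s) * c (rshift n s) l
                      - B (rshift n s) * c (lshift n s) l) = 0) ->
  forall j, B j = 0.
Proof.
move=> cd Bc; have key r : \sum_s (B (lshift n s) * (rshift n s == r)%:R
                                 - B (rshift n s) * (lshift n s == r)%:R) = 0.
  transitivity (\sum_l (\sum_s (B (lshift n s) * c (rshift n s) l
                   - B (rshift n s) * c (lshift n s) l)) * d l r); last first.
    by rewrite big1 // => l _; rewrite Bc mul0r.
  under [RHS]eq_bigr => l _ do rewrite mulr_suml.
  rewrite exchange_big; apply: eq_bigr => s _ /=.
  under [RHS]eq_bigr => l _ do rewrite mulrBl -!mulrA.
  by rewrite sumrB -!mulr_sumr !cd.
move=> j; rewrite -[j]splitK; case: (split j) => s /=.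
  have := key (rshift n s); rewrite (bigD1 s) //= big1 ?addr0 => [|s' ne].
    by rewrite eqxx mulr1 eq_lrshift mulr0 subr0.
  by rewrite eq_lrshift eq_rshift (negbTE ne) !mulr0 subr0.
have := key (lshift n s); rewrite (bigD1 s) //= big1 ?addr0 => [|s' ne].
  by rewrite eqxx mulr1 eq_rlshift mulr0 sub0r => /eqP; rewrite oppr_eq0 => /eqP.
by rewrite eq_rlshift eq_lshift (negbTE ne) !mulr0 subr0.
Qed.

End SymplecticCancellation.

(** * Matrix coefficients of a filtered action *)

Section WeylAction.
Variables (k : fieldType) (n : nat) (H : fdHopfType k).
Local Notation W := {mpoly k[n + n]}.
Local Notation D := (conv H k^o).
Variable act : H -> W -> W.
Hypothesis act_weyl : modulePoissonAlgebra (weyl_poisson k n) act.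
Hypothesis act_filt : preservesFiltration act.
Implicit Types (a b : W) (h x y : H) (i j l : 'I_(n + n)) (m : 'X_{1..n + n}).
Local Notation P := (weyl_poisson k n).

Let actl a : linear (act^~ a) := act_linearl act_weyl a.
Let actr h : linear (act h) := act_linearr act_weyl h.

Definition acth (h : H) (a : W) : W := act h a.
HB.instance Definition _ h := GRing.isLinear.Build k W W _ (acth h) (actr h).

Definition actc a m (h : H) : k^o := (act h a)@_m.
Lemma actc_is_linear a m : linear (actc a m).
Proof. by move=> u x y; rewrite /actc actl mcoeffD mcoeffZ. Qed.
HB.instance Definition _ a m :=
  GRing.isLinear.Build k H k^o _ (actc a m) (actc_is_linear a m).

(** In the notation c_0i, c_ji for the action on generators, [coef 'X_i 0%MM] is c_0i and
    [coef 'X_i U_(j)%MM] is c_ji. *)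
Definition coef a m : D := cmk (actc a m).
Lemma coefE a m h : coef a m h = (act h a)@_m.
Proof. exact: cmkE. Qed.

Lemma coefP (u : k) a b m : coef (u *: a + b) m = u *: coef a m + coef b m.
Proof.
by apply: convP => h; rewrite convlE !coefE actr mcoeffD mcoeffZ.
Qed.

Lemma act_X2 h i : (msize (act h 'X_i) <= 2)%N.
Proof. by apply: (act_filt (d := 1)); rewrite inE msizeX mdeg1. Qed.

Lemma coef_one m : coef 1 m = (m == 0%MM)%:R *: 1.
Proof.
apply: convP => h; rewrite coefE (act_unit act_weyl) mcoeffZ mcoeff1 convZ conv1.
by rewrite [RHS]mulrC; congr (_ * _); apply/esym/mulr1.
Qed.

(** Preservation of the filtration makes y x_i affine, so acting by x on it involves only 1 and the
    variables. *)
Lemma coefX_mul i m x y : coef 'X_i m (x * y) =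
  coef 1 m x * coef 'X_i 0%MM y + \sum_j coef 'X_j m x * coef 'X_i U_(j)%MM y.
Proof.
rewrite coefE (act_mul act_weyl) [in LHS](msize2_expand (act_X2 y i)).
rewrite actr mcoeffD mcoeffZ mulrC !coefE; congr (_ + _).
rewrite -[act x _]/(acth x _) linear_sum linear_sum; apply: eq_bigr => j _.
by rewrite linearZ /= mcoeffZ mulrC !coefE.
Qed.

Lemma coefM a b m : coef (a * b) m =
  \sum_(q : 'X_{1..(n + n) < (mdeg m).+1, (mdeg m).+1} | m == (q.1 + q.2)%MM)
    coef a q.1 * coef b q.2.
Proof.
apply: convP => h; rewrite coefE (act_prod act_weyl).
pose c (p : W) : k^o := p@_m.
have lc : linear c by move=> u p q; rewrite /c mcoeffD mcoeffZ.
rewrite -[LHS]/(c _) (linear_tlift _ _ lc).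
rewrite -[capp _]/(fun_of_lfun _) sum_lfunE.
transitivity (tlift (fun x y =>
  \sum_(q : 'X_{1..(n + n) < (mdeg m).+1, (mdeg m).+1} | m == (q.1 + q.2)%MM)
    coef a q.1 x * coef b q.2 y) (comul h)).
  by apply: eq_tlift => x y; rewrite /c mcoeffM; apply: eq_bigr => q _; rewrite !coefE.
by rewrite tlift_sum; apply: eq_bigr => q _; rewrite -convM.
Qed.

(** The constant term is a ring morphism; with commutativity of polynomials this makes constant
    coefficients commute. *)
Lemma coef0M a b : coef (a * b) 0%MM = coef a 0%MM * coef b 0%MM.
Proof.
apply: convP => h; rewrite coefE (act_prod act_weyl) convM.
pose c (p : W) : k^o := p@_0%MM.
have lc : linear c by move=> u p q; rewrite /c mcoeffD mcoeffZ.
rewrite -[LHS]/(c _) (linear_tlift _ _ lc).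
by apply: eq_tlift => x y; rewrite /c rmorphM /= !coefE.
Qed.

Lemma coef_act1 a m : coef a m 1 = a@_m.
Proof. by rewrite coefE (act_one act_weyl). Qed.

Definition coefS j l : D := cmk (coef 'X_l U_(j)%MM \o antipode).

(* The linear coefficients form a comodule matrix, so composing them with the
   antipode gives its inverse. *)
Lemma coef_coefS i l :
  \sum_j coef 'X_j U_(i)%MM * coefS j l = (i == l)%:R *: 1.
Proof.
apply: convP => h; rewrite conv_sum.
transitivity (coef 'X_l U_(i)%MM ((counit h : k) *: 1)); last first.
  rewrite linearZ /= coef_act1 mcoeffXU convZ conv1 eq_sym.
  by rewrite [RHS]mulrC; congr (_ * _); apply/esym/mulr1.
rewrite -antipoder linear_tlift; last exact: linearP.
under eq_bigr => j _ do rewrite convM.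
rewrite -tlift_sum; apply: eq_tlift => x y; rewrite coefX_mul coef_one.
rewrite mnm1_eq0 scale0r conv0 mul0r add0r; apply: eq_bigr => j _.
by rewrite [coefS _ _ _]cmkE.
Qed.

(* Compare the two expansions of the action on {x_i, a x_l}: through the bracket
   first, or through the Leibniz rule first. *)
Lemma coef_bracket a m i l :
  \sum_s (coef 'X_i U_(lshift n s)%MM * (coef a m * coef 'X_l U_(rshift n s)%MM)
        - coef 'X_i U_(rshift n s)%MM * (coef a m * coef 'X_l U_(lshift n s)%MM))
  = \sum_s (coef a m * (coef 'X_i U_(lshift n s)%MM * coef 'X_l U_(rshift n s)%MM)
        - coef a m * (coef 'X_i U_(rshift n s)%MM * coef 'X_l U_(lshift n s)%MM)).
Proof.
apply: convP => h; rewrite !conv3_sum.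
pose K x v : k := \sum_s
  ((act x 'X_i)@_U_(lshift n s) * (act v 'X_l)@_U_(rshift n s)
   - (act x 'X_i)@_U_(rshift n s) * (act v 'X_l)@_U_(lshift n s)).
have PK x v : P (act x 'X_i) (act v 'X_l) = K x v *: 1.
  by apply: weyl_bracket_affine; apply: act_X2.
have Pr f : linear (P f) by apply: pbracket_linearr.
(* [T1] and [T2] are the Leibniz terms of the bracket of x x_i with (u a)(v x_l). Both expansions
   contain [T1] with the same distribution of h_1, h_2, h_3, so it cancels; in [T2] the roles of h_1
   and h_2 are exchanged. *)
pose T1 x u v : W := P (act x 'X_i) (act u a) * act v 'X_l.
pose T2 x u v : W := act u a * (K x v *: 1).
have key : tlift (fun x y => tlift (fun u v => T2 x u v) (comul y)) (comul h) =
           tlift (fun u y => tlift (fun x v => T2 x u v) (comul y)) (comul h).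
  have eL : act h (P 'X_i (a * 'X_l)) =
      tlift (fun x y => tlift (fun u v => T1 x u v) (comul y)) (comul h) +
      tlift (fun u y => tlift (fun x v => T2 x u v) (comul y)) (comul h).
    rewrite pbracket_leibniz -[act h _]/(acth h _) linearD /= /acth.
    rewrite !(act_prod act_weyl) -tlift_coassoc; last 1 first.
    - by move=> x u c f g; rewrite /T1 actl mulrDr -scalerAr.
    - congr (_ + _); apply: eq_tlift => x y.
        rewrite (act_bracket act_weyl).
        rewrite (linear_tlift (f := fun z => z * act y 'X_l)) //.
        by move=> c f g; rewrite mulrDl -scalerAl.
      rewrite (act_bracket act_weyl).
      rewrite (linear_tlift (f := fun z => act x a * z)); last first.
        by move=> c f g; rewrite mulrDr -scalerAr.
      by apply: eq_tlift => u v; rewrite PK.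
    - by move=> u v c f g; rewrite /T1 actl pbracket_linearl mulrDl -scalerAl.
    by move=> x v c f g; rewrite /T1 actl Pr mulrDl -scalerAl.
  have eR : act h (P 'X_i (a * 'X_l)) =
      tlift (fun x y => tlift (fun u v => T1 x u v) (comul y)) (comul h) +
      tlift (fun x y => tlift (fun u v => T2 x u v) (comul y)) (comul h).
    rewrite (act_bracket act_weyl) -tlift_add; apply: eq_tlift => x y.
    rewrite (act_prod act_weyl) (linear_tlift _ _ (Pr _)) -tlift_add.
    by apply: eq_tlift => u v; rewrite pbracket_leibniz PK.
  by move: eR; rewrite eL => /addrI.
pose c (p : W) : k^o := p@_m.
have lc : linear c by move=> r p q; rewrite /c mcoeffD mcoeffZ.
have cT2 x u v : c (T2 x u v) = \sum_s
   (coef 'X_i U_(lshift n s)%MM x * coef a m u * coef 'X_l U_(rshift n s)%MM v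
   - coef 'X_i U_(rshift n s)%MM x * coef a m u * coef 'X_l U_(lshift n s)%MM v).
  rewrite /c /T2 mulr_algr mcoeffZ /K mulr_suml.
  have sumE (F G : 'I_n -> k) : F =1 G ->
      \sum_s F s = \sum_s (G s : k^o) :> k^o by move=> FG; exact: eq_bigr.
  by apply: sumE => s; rewrite !coefE mulrBl ![_ * _ * (act u a)@_m]mulrAC.
transitivity (c (tlift (fun x y => tlift (fun u v => T2 x u v) (comul y)) (comul h))).
  rewrite (linear_tlift _ _ lc); apply: eq_tlift => x y.
  by rewrite (linear_tlift _ _ lc); apply: eq_tlift => u v; rewrite cT2.
rewrite key (linear_tlift _ _ lc); apply: eq_tlift => u y.
rewrite (linear_tlift _ _ lc); apply: eq_tlift => x v.
by rewrite cT2; apply: eq_bigr => s _; congr (_ * _ - _ * _); apply: mulrC.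
Qed.

(** [coef_bracket] is a symplectic relation between the commutators [B p] and the matrix (c_pl),
    whose right inverse is [coefS]. *)
Lemma coef_linear_comm a m i j :
  coef a m * coef 'X_i U_(j)%MM = coef 'X_i U_(j)%MM * coef a m.
Proof.
pose B p : D := coef 'X_i U_(p)%MM * coef a m - coef a m * coef 'X_i U_(p)%MM.
suff : B j = 0 by move/eqP; rewrite subr_eq0 => /eqP.
apply: (symplectic_cancel (c := fun p l => coef 'X_l U_(p)%MM) (d := coefS)) => [p r|l].
  by rewrite coef_coefS; case: eqP; rewrite ?scale1r ?scale0r.
have /eqP := coef_bracket a m i l; rewrite -subr_eq0 -sumrB => /eqP E; rewrite -[RHS]E.
by apply: eq_bigr => s _; exact: commutator_mulB.
Qed.

(** * The subalgebra generated by the coefficients of the variables *)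

Definition affine_mnm : seq 'X_{1..n + n} := 0%MM :: [seq U_(j)%MM | j : 'I_(n + n)].

Lemma affine_mnmP m : m \in affine_mnm -> m = 0%MM \/ exists j, m = U_(j)%MM.
Proof.
rewrite inE => /orP[/eqP|/mapP[j _ ->]]; first by left.
by right; exists j.
Qed.

Definition gens : {vspace D} :=
  <<[seq coef 'X_i m | i <- enum 'I_(n + n), m <- affine_mnm]>>%VS.
Definition coef_alg : {vspace D} := agenv gens.

Lemma gens_coef i m : m \in affine_mnm -> coef 'X_i m \in gens.
Proof.
move=> mA; apply/memv_span/allpairsP; exists (i, m).
by split=> //=; rewrite mem_enum.
Qed.

Lemma gens_ind (Pr : D -> Prop) :
    (forall r f g, Pr f -> Pr g -> Pr (r *: f + g)) -> Pr 0 ->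
    (forall i m, m \in affine_mnm -> Pr (coef 'X_i m)) ->
  forall f, f \in gens -> Pr f.
Proof.
move=> PD P0 PX f; rewrite /gens; set s := [seq coef 'X_i m | i <- _, m <- _].
have : forall g, g \in s -> Pr g by move=> _ /allpairsP[[i m] [_ mA ->]]; apply: PX.
elim: s f => [|g s IH] f Ps; first by rewrite span_nil memv0 => /eqP->.
rewrite span_cons => /memv_addP[_ /vlineP[r ->] [z zs ->]].
apply: PD; first exact/Ps/mem_head.
by apply: IH => // w ws; apply: Ps; rewrite inE ws orbT.
Qed.

Lemma coef_alg1 : 1 \in coef_alg.
Proof. by rewrite memvE sub1_agenv. Qed.

Lemma coef_algM f g : f \in coef_alg -> g \in coef_alg -> f * g \in coef_alg.
Proof. by move=> fC gC; rewrite /coef_alg -agenvM memv_mul. Qed.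

Lemma gens_coef_alg f : f \in gens -> f \in coef_alg.
Proof. exact/subvP/sub_agenv. Qed.

(** [coef_linear_comm] applies as soon as one coefficient is linear; two constant ones are handled
    by [coef0M]. *)
Lemma gens_comm i m j m' : m \in affine_mnm -> m' \in affine_mnm ->
  coef 'X_i m * coef 'X_j m' = coef 'X_j m' * coef 'X_i m.
Proof.
move=> mA /affine_mnmP[->|[q ->]]; last exact: coef_linear_comm.
case/affine_mnmP: mA => [->|[p ->]]; last exact/esym/coef_linear_comm.
by rewrite -!coef0M [X in coef X _]mulrC.
Qed.

(** A centraliser is a subalgebra, so commutation spreads from the generators to the generated
    algebra, one argument at a time. *)
Lemma coef_algC f g : f \in coef_alg -> g \in coef_alg -> f * g = g * f.
Proof.
have cent (u : D) : (forall g, g \in gens -> u * g = g * u) ->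
    forall g, g \in coef_alg -> u * g = g * u.
  move=> uG; apply: agenv_ind => [|r x y ux uy|x y xG uy].
  - by rewrite mulr1 mul1r.
  - by rewrite mulrDr mulrDl -scalerAr -scalerAl ux uy.
  by rewrite mulrA uG // -mulrA uy mulrA.
have centg (u : D) : (forall i m, m \in affine_mnm -> u * coef 'X_i m = coef 'X_i m * u) ->
    forall g, g \in gens -> u * g = g * u.
  move=> uX; apply: gens_ind => [r x y ux uy||]; last exact: uX.
    by rewrite mulrDr mulrDl -scalerAr -scalerAl ux uy.
  by rewrite mulr0 mul0r.
move=> fC gC; apply: (cent f _ g gC) => g' g'G; apply/esym.
apply: (cent g' _ f fC) => f' f'G; apply: (centg g' _ f' f'G) => i m mA; apply/esym.
apply: (centg _ _ g' g'G) => j m' m'A.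
exact: gens_comm.
Qed.

(** By [coefX_mul] a left translate of a generator is a combination of c_0i and the c_ji. The
    induction keeps h general because a translate of a product involves both legs of its
    comultiplication. *)
Lemma coef_alg_shiftl f h : f \in coef_alg -> conv_shiftl h f \in coef_alg.
Proof.
move=> fC; move: f fC h; apply: agenv_ind => [h|r f g fC gC h|f g fG gC h].
- by rewrite conv_shiftl1 memvZ ?coef_alg1.
- by rewrite conv_shiftlP; apply: memvD (memvZ _ (fC h)) (gC h).
rewrite conv_shiftlM; apply: tlift_memv => x y; apply: coef_algM; last exact: gC.
move: f fG {g gC y}; apply: gens_ind => [r f g fC gC||i m mA].
- by rewrite conv_shiftlP; apply: memvD (memvZ _ fC) gC.
- have -> : conv_shiftl x (0 : D) = 0; last exact: mem0v.
  by apply: convP => z; rewrite conv_shiftlE !conv0.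
have -> : conv_shiftl x (coef 'X_i m) = (coef 1 m x : k) *: coef 'X_i 0%MM +
    \sum_j (coef 'X_j m x : k) *: coef 'X_i U_(j)%MM.
  apply: convP => y; rewrite conv_shiftlE coefX_mul convD convZ conv_sum.
  by congr (_ + _); apply: eq_bigr => j _; rewrite convZ.
apply: memvD; first by apply/memvZ/gens_coef_alg/gens_coef/mem_head.
apply: memv_suml => j _; apply/memvZ/gens_coef_alg/gens_coef.
by rewrite inE map_f ?orbT // mem_enum.
Qed.

Lemma coef_alg_shiftr f h : f \in coef_alg -> conv_shiftr h f \in coef_alg.
Proof.
move=> fC; move: f fC h; apply: agenv_ind => [h|r f g fC gC h|f g fG gC h].
- by rewrite conv_shiftr1 memvZ ?coef_alg1.
- by rewrite conv_shiftrP; apply: memvD (memvZ _ (fC h)) (gC h).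
rewrite conv_shiftrM; apply: tlift_memv => x y; apply: coef_algM; last exact: gC.
move: f fG {g gC y}; apply: gens_ind => [r f g fC gC||i m mA].
- by rewrite conv_shiftrP; apply: memvD (memvZ _ fC) gC.
- have -> : conv_shiftr x (0 : D) = 0; last exact: mem0v.
  by apply: convP => z; rewrite conv_shiftrE !conv0.
have -> : conv_shiftr x (coef 'X_i m) = (coef 'X_i 0%MM x : k) *: coef 1 m +
    \sum_j (coef 'X_i U_(j)%MM x : k) *: coef 'X_j m.
  apply: convP => y; rewrite conv_shiftrE coefX_mul convD convZ conv_sum.
  congr (_ + _); first exact: mulrC.
  by apply: eq_bigr => j _; rewrite convZ; apply: mulrC.
apply: memvD; first by rewrite coef_one; do 2 apply: memvZ; apply: coef_alg1.
by apply: memv_suml => j _; apply/memvZ/gens_coef_alg/gens_coef.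
Qed.

(** By [coefM] the coefficients of a product are sums of products of coefficients of its factors, so
    the variables suffice; their coefficients in degree above one vanish by the filtration. *)
Lemma coef_in_alg a m : coef a m \in coef_alg.
Proof.
have PD r b b' : (forall m, coef b m \in coef_alg) -> (forall m, coef b' m \in coef_alg) ->
    forall m, coef (r *: b + b') m \in coef_alg.
  by move=> bC b'C m'; rewrite coefP; apply: memvD (memvZ _ (bC m')) (b'C m').
have PM b b' : (forall m, coef b m \in coef_alg) -> (forall m, coef b' m \in coef_alg) ->
    forall m, coef (b * b') m \in coef_alg.
  move=> bC b'C m'; rewrite coefM; apply: memv_suml => q _.
  exact: coef_algM.
have P1 m' : coef 1 m' \in coef_alg by rewrite coef_one memvZ ?coef_alg1.
have P0 m' : coef 0 m' \in coef_alg.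
  by have := PD (-1) 1 1 P1 P1 m'; rewrite scaleN1r addNr.
have PX i m' : coef 'X_i m' \in coef_alg.
  have [mA|mA] := boolP (m' \in affine_mnm); first exact/gens_coef_alg/gens_coef.
  suff -> : coef 'X_i m' = 0 by rewrite mem0v.
  apply: convP => h; rewrite coefE conv0; apply: msize2_coef0; first exact: act_X2.
  rewrite ltnNge; apply: contra mA; rewrite leq_eqVlt ltnS leqn0 inE mdeg_eq0.
  case/orP => [/mdeg1P[j /eqP ->]|->//]; apply/orP; right.
  by apply: map_f; rewrite mem_enum.
move: m; elim/mpolyind: a => [//|c m a _ _ IH]; apply: PD => //.
rewrite mpolyXE_id; apply: (big_ind (fun b => forall m, coef b m \in coef_alg)) => //.
by move=> i _; elim: (m i) => [|e IHe]; rewrite ?expr0 // exprS; apply: PM.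
Qed.

End WeylAction.

(** * Passage to the quotient by the annihilator of the coefficient algebra *)

Theorem corollary3p8 (k : closedFieldType) (pchar0 : [pchar k] =i pred0)
    (n : nat) (n_ge1 : (1 <= n)%N) (H : fdHopfType k)
    (act : H -> {mpoly k[n + n]} -> {mpoly k[n + n]})
    (act_weyl : modulePoissonAlgebra (weyl_poisson k n) act)
    (act_filt : preservesFiltration act) :
  factorsThroughGroupAlgebra act.
Proof.
have [I IC] : exists I : hopfIdeal H, (I : {vspace H}) = annih (coef_alg act_weyl).
  apply: annih_hopfIdeal.
  - exact: coef_alg1.
  - exact: coef_algM.
  - exact: coef_alg_shiftl.
  exact: coef_alg_shiftr.
exists I; split=> [h a|].
  rewrite IC => /annihP hC; apply/mpolyP => m; rewrite mcoeff0.
  by have := hC _ (coef_in_alg act_weyl act_filt a m); rewrite coefE.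
apply: cocommutative_group_algebra => //; apply: (hopf_quot_comulC IC).
exact: coef_algC.
Qed.
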